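(* Let $(M,\omega,H)$ be a completely integrable Hamiltonian system of dimension $2n$ with integrals of motion $f_1=H,f_2,\dots,f_n$, and let $\pi=(f_1,\dots,f_n):(M,\omega)\to B$ be the associated Lagrangian fibration. If the Hamiltonian vector fields $\mathbb{X}_{f_1},\dots,\mathbb{X}_{f_n}$ are complete on $\pi^{-1}(b)$ for each $b\in B$, then the Lagrangian fibration $\pi:(M,\omega)\to B$ is complete.
   Context: A Hamiltonian system $(M,\omega,H)$ is a symplectic manifold $(M,\omega)$ with a function $H\in C^\infty(M,\mathbb{R})$. The Hamiltonian vector field of $f\in C^\infty(M,\mathbb{R})$ is defined by $\omega(\mathbb{X}_f,\cdot)=\mathrm{d}f$. The system is completely integrable if there are $n=\frac12\dim M$ functions $f_1=H,\dots,f_n$ (integrals of motion) whose differentials are linearly independent at every point of $M$ and with $\omega(\mathbb{X}_{f_i},\mathbb{X}_{f_j})=0$ for all $i,j$. A Lagrangian fibration $\pi:(M,\omega)\to B$ is a smooth surjective submersion from a symplectic manifold of dimension $2n$ onto an open subset $B\subset\mathbb{R}^n$ such that each fibre $\pi^{-1}(b)$ is a Lagrangian submanifold. For a $1$-form $\alpha$ on $B$, the vector field $X_{\pi^*\alpha}$ on $M$ is defined by $\omega(X_{\pi^*\alpha},\cdot)=\pi^*\alpha$. The Lagrangian fibration is complete if $X_{\pi^*\alpha}$ is a complete vector field for every compactly supported $1$-form $\alpha$ on $B$. *)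

(* Defs.v *)
From HB Require Import structures.
From mathcomp Require Import all_boot all_order all_algebra.
From mathcomp Require Import all_classical all_reals all_analysis.

Set Implicit Arguments.
Unset Strict Implicit.
Unset Printing Implicit Defensive.

Import Order.TTheory GRing.Theory Num.Theory numFieldNormedType.Exports.
Local Open Scope classical_set_scope.
Local Open Scope ring_scope.

Section Smooth.
Context {R : realType} {m : nat} {W : normedModType R}.
Implicit Types (U : set 'rV[R]_m) (g : 'rV[R]_m -> W).

(* As 'rV[R]_m is finite dimensional, x |-> 'd g x is of class C^k for the
   operator norm iff x |-> 'd g x v is of class C^k for every fixed v. *)
Fixpoint class_C (k : nat) U g : Prop :=
  if k is k'.+1 then
    (forall x, U x -> differentiable g x) /\
    (forall v, class_C k' U (fun x => 'd g x v))
  else forall x, U x -> {for x, continuous g}.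

Definition smooth_on U g := forall k, class_C k U g.

End Smooth.

(* chart_fun is meaningful on chart_dom only, chart_inv on the image of
   chart_dom only. *)
Record chart (R : realType) (T : topologicalType) (m : nat) := Chart {
  chart_dom : set T;
  chart_fun : T -> 'rV[R]_m;
  chart_inv : 'rV[R]_m -> T;
  chart_dom_open : open chart_dom;
  chart_cod_open : open (chart_fun @` chart_dom);
  chart_funK : forall p, chart_dom p -> chart_inv (chart_fun p) = p;
  chart_fun_continuous : forall p, chart_dom p ->
    {for p, continuous chart_fun};
  chart_inv_continuous : forall x, (chart_fun @` chart_dom) x ->
    {for x, continuous chart_inv} }.

Definition transition (R : realType) (T : topologicalType) (m : nat)
  (c c' : chart R T m) : 'rV[R]_m -> 'rV[R]_m := chart_fun c' \o chart_inv c.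

Record manifold (R : realType) (m : nat) := Manifold {
  mpoint :> topologicalType;
  mindex : Type;
  mchart : mindex -> chart R mpoint m;
  manifold_hausdorff : hausdorff_space mpoint;
  manifold_second_countable : @second_countable mpoint;
  manifold_cover : forall p, exists c, chart_dom (mchart c) p;
  manifold_compat : forall c c',
    smooth_on
      (chart_fun (mchart c) @` (chart_dom (mchart c) `&` chart_dom (mchart c')))
      (transition (mchart c) (mchart c')) }.

Arguments mchart {R m M} _ : rename.

Section Manifold.
Context {R : realType} {m : nat} (M : manifold R m).
Implicit Types (c : mindex M) (p : M).

Definition dom c : set M := chart_dom (mchart c).
Definition coord c : M -> 'rV[R]_m := chart_fun (mchart c).
Definition param c : 'rV[R]_m -> M := chart_inv (mchart c).

Definition msmooth_on {W : normedModType R} (U : set M) (g : M -> W) :=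
  forall c, smooth_on (coord c @` (dom c `&` U)) (g \o param c).

Definition msmooth {W : normedModType R} (g : M -> W) := msmooth_on setT g.

(* A tangent vector at p is given by its components v in each chart c around
   p, the components in two charts c and c' being related by the differential
   of the transition map; accordingly vector fields, 1-forms and 2-forms are
   families indexed by the charts.  Only their values at (c, p) with p in
   dom c are meaningful. *)
Definition vfield := mindex M -> M -> 'rV[R]_m.
Definition form1 := mindex M -> M -> 'rV[R]_m -> R.

Definition mdiff {W : normedModType R} (g : M -> W) c p (v : 'rV[R]_m) : W :=
  'd (g \o param c) (coord c p) v.

Definition bilin (A : 'M[R]_m) (u v : 'rV[R]_m) : R := (u *m A *m v^T) 0 0.

Record symplectic := Symplectic {
  smx : mindex M -> M -> 'M[R]_m;
  smx_smooth : forall c u v,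
    smooth_on (coord c @` dom c) (fun x => bilin (smx c (param c x)) u v);
  smx_tensor : forall c c' p u v, dom c p -> dom c' p ->
    let tau := transition (mchart c) (mchart c') in
    bilin (smx c p) u v =
    bilin (smx c' p) ('d tau (coord c p) u) ('d tau (coord c p) v);
  smx_alternating : forall c p u, dom c p -> bilin (smx c p) u u = 0;
  smx_nondegenerate : forall c p u, dom c p ->
    (forall v, bilin (smx c p) u v = 0) -> u = 0;
  (* d omega (u, v, w) for the constant fields u, v, w of the chart c, whose
     brackets vanish *)
  smx_closed : forall c x u v w, (coord c @` dom c) x ->
    let om a b := fun y => bilin (smx c (param c y)) a b in
    'd (om v w) x u + 'd (om w u) x v + 'd (om u v) x w = 0 }.

Definition sform (omega : symplectic) c p (u v : 'rV[R]_m) : R :=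
  bilin (smx omega c p) u v.

(* The vector field X such that omega (X, _) = a; see sharpP and sharp_uniq. *)
Definition sharp (omega : symplectic) (a : form1) : vfield := fun c p =>
  get [set u | forall v, sform omega c p u v = a c p v].

Definition hamiltonian_vfield (omega : symplectic) (h : M -> R) : vfield :=
  sharp omega (mdiff h).

Definition integral_curve (X : vfield) (gamma : R -> M) :=
  continuous gamma /\
  forall c (t : R), dom c (gamma t) ->
    is_derive t 1 (coord c \o gamma) (X c (gamma t)).

(* For X tangent to A: completeness of the restriction of X to A. *)
Definition complete_on (A : set M) (X : vfield) :=
  forall p, A p -> exists gamma : R -> M,
    [/\ gamma 0 = p, integral_curve X gamma & forall t, A (gamma t)].

Definition complete_vfield (X : vfield) := complete_on setT X.

Definition lin_indep {n : nat} (a : 'I_n -> 'rV[R]_m -> R) :=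
  forall k : 'I_n -> R,
    (forall v, \sum_(i < n) k i * a i v = 0) -> forall i, k i = 0.

Definition submersion_at {n : nat} (g : M -> 'rV[R]_n) p :=
  forall c, dom c p -> forall w, exists v, mdiff g c p v = w.

End Manifold.

Section Nondegenerate.
Context {R : realType} {m : nat} (M : manifold R m) (omega : symplectic M).

Lemma sform_unitmx (c : mindex M) (p : M) : dom c p ->
  smx omega c p \in unitmx.
Proof.
move=> cp; rewrite -row_free_unit -kermx_eq0; apply/eqP/row_matrixP => i.
rewrite row0; apply: (@smx_nondegenerate _ _ _ omega _ _ _ cp) => v.
by rewrite /bilin -row_mul mulmx_ker row0 mul0mx mxE.
Qed.

Lemma sharpP (a : form1 M) (c : mindex M) (p : M) : dom c p ->
  linear (a c p : 'rV[R]_m -> R^o) ->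
  forall v, sform omega c p (sharp omega a c p) v = a c p v.
Proof.
move=> cp alin; rewrite /sharp.
apply: (getPex (P := [set u | forall v, sform omega c p u v = a c p v])).
pose L : {linear 'rV[R]_m -> R^o} :=
  HB.pack (a c p : 'rV[R]_m -> R^o)
    (GRing.isLinear.Build _ _ _ _ (a c p : 'rV[R]_m -> R^o) alin).
exists ((\row_j a c p (delta_mx 0 j)) *m invmx (smx omega c p)) => v /=.
rewrite /sform /bilin mulmxKV ?sform_unitmx// mxE.
rewrite -[RHS]/(L v) [in RHS](row_sum_delta v) linear_sum.
by apply: eq_bigr => j _; rewrite !mxE linearZ /= mulrC.
Qed.

Lemma sharp_uniq (a : form1 M) (c : mindex M) (p : M) u : dom c p ->
  (forall v, sform omega c p u v = a c p v) -> u = sharp omega a c p.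
Proof.
move=> cp ua; rewrite /sharp.
have Pu : [set u | forall v, sform omega c p u v = a c p v] u by [].
have := getI Pu; set w := get _ => wa; apply/eqP; rewrite -subr_eq0; apply/eqP.
apply: (@smx_nondegenerate _ _ _ omega _ _ _ cp) => v; rewrite /bilin !mulmxBl mxE [X in _ + X]mxE.
by move: (ua v) (wa v); rewrite /sform /bilin => -> ->; rewrite subrr.
Qed.

Lemma hamiltonian_vfieldP (h : M -> R) (c : mindex M) (p : M) : dom c p ->
  forall v, sform omega c p (hamiltonian_vfield omega h c p) v = mdiff h c p v.
Proof.
move=> cp; apply: sharpP => // k u v.
exact: linearP.
Qed.

End Nondegenerate.

Section Integrable.
Context {R : realType} {n : nat} (M : manifold R (2 * n)%N).
Variable omega : symplectic M.

Record completely_integrable (H : M -> R) (f : 'I_n -> M -> R) := {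
  ci_smooth : forall i, msmooth (f i);
  ci_first : forall i : 'I_n, i = 0%N :> nat -> f i = H;
  ci_indep : forall c p, dom c p ->
    lin_indep (fun i : 'I_n => mdiff (f i) c p);
  ci_commute : forall c p (i j : 'I_n), dom c p ->
    sform omega c p (hamiltonian_vfield omega (f i) c p)
                    (hamiltonian_vfield omega (f j) c p) = 0 }.

Definition fibre (pi : M -> 'rV[R]_n) (b : 'rV[R]_n) : set M :=
  [set p | pi p = b].

(* L is an embedded submanifold of codimension n, given locally as the zero
   set of a submersion g; its tangent space at p is the kernel of the
   differential of g, and omega vanishes on it. *)
Definition lagrangian_submanifold (L : set M) :=
  forall p, L p -> exists (U : set M) (g : M -> 'rV[R]_n),
    [/\ open U, U p, msmooth_on U g,
        (forall q, U q -> submersion_at g q /\ (L q <-> g q = 0)) &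
        forall c q u v, U q -> L q -> dom c q ->
          mdiff g c q u = 0 -> mdiff g c q v = 0 -> sform omega c q u v = 0].

Record lagrangian_fibration (pi : M -> 'rV[R]_n) (B : set 'rV[R]_n) := {
  lf_open : open B;
  lf_image : range pi = B;
  lf_smooth : msmooth pi;
  lf_submersion : forall p, submersion_at pi p;
  lf_lagrangian : forall b, B b -> lagrangian_submanifold (fibre pi b) }.

(* A 1-form on B is given by its components: alpha b v = \sum_i alpha_i b * v_i. *)
Definition pullback (pi : M -> 'rV[R]_n) (alpha : 'rV[R]_n -> 'rV[R]_n) :
    form1 M :=
  fun c p v => \sum_(i < n) alpha (pi p) 0 i * mdiff pi c p v 0 i.

Lemma sharp_pullbackP (pi : M -> 'rV[R]_n) (alpha : 'rV[R]_n -> 'rV[R]_n)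
    (c : mindex M) (p : M) : dom c p ->
  forall v, sform omega c p (sharp omega (pullback pi alpha) c p) v =
            pullback pi alpha c p v.
Proof.
move=> cp; apply: sharpP => // k u v; rewrite /pullback scaler_sumr -big_split.
apply: eq_bigr => i _; rewrite /mdiff linearP /= !mxE mulrDr mulrCA.
by [].
Qed.

Definition compactly_supported (B : set 'rV[R]_n)
    (alpha : 'rV[R]_n -> 'rV[R]_n) :=
  exists K : set 'rV[R]_n,
    [/\ compact K, K `<=` B & forall b, B b -> ~ K b -> alpha b = 0].

Definition complete_lagrangian_fibration (pi : M -> 'rV[R]_n)
    (B : set 'rV[R]_n) :=
  lagrangian_fibration pi B /\
  forall alpha : 'rV[R]_n -> 'rV[R]_n,
    smooth_on B alpha -> compactly_supported B alpha ->
    complete_vfield (sharp omega (pullback pi alpha)).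

Definition momentum_map (f : 'I_n -> M -> R) : M -> 'rV[R]_n :=
  fun p => \row_i f i p.

End Integrable.

(* Main.v *)
Require Import Defs.
From HB Require Import structures.
From mathcomp Require Import all_boot all_order all_algebra.
From mathcomp Require Import all_classical all_reals all_analysis.
From mathcomp Require Import ring lra.

Set Implicit Arguments.
Unset Strict Implicit.
Unset Printing Implicit Defensive.

Import Order.TTheory GRing.Theory Num.Theory numFieldNormedType.Exports.
Local Open Scope classical_set_scope.
Local Open Scope ring_scope.

(** Fix a fibre of the momentum map [pi], over [b] say.  On it the coefficients
    of [pi^* alpha] are the constants [a_i = alpha b 0 i], so that its vector
    field coincides there with the Hamiltonian field of [\sum_i a_i f_i].  It
    thus suffices to show that a linear combination of the [f_i] has a
    Hamiltonian field that is complete on the fibre ([complete_pullback],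
    [complete_ham_sum]).

    Multiplying a field by a constant rescales the time of its integral curves.
    For a sum of two fields [Y] and [Z] the point is that they commute
    ([bracket_ham]), which follows from [{g, h} = 0] and the closedness of the
    symplectic form.  Given an integral curve [zeta] of [Z], choose for every [t]
    an integral curve [Gamma^~ t] of [Y] with [Gamma 0 t = zeta t].  Then [Gamma]
    has partial derivatives [Y] and [Z], and its diagonal is an integral curve
    of [Y + Z] ([integral_curve_diagonal]).  That the derivative in [t] is [Z] is
    known at [s = 0] and propagates in [s]: on short windows of time inside a
    chart, Gronwall's lemma shows that the first-order defect
    [Gamma s (t + h) - Gamma s t - h Z(Gamma s t)] stays [o(h)]
    ([transported_window]).  The Hausdorff property ensures that a curve of
    bounded speed does not leave a chart too early ([stay_in_chart]).

    That [pi] is a Lagrangian fibration is linear algebra at each point, since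
    the kernel of the differential of [pi] is spanned by the Hamiltonian vectors
    of the [f_i] ([kernel_momentum]), except for the openness of its image, which
    is the local surjectivity of submersions ([submersion_locally_onto]). *)

(* [coord] is also the name of the coordinates on a basis of a vector space. *)
Local Notation coord := Defs.coord.

(** * Differentials and derivatives of curves *)

Section DiffBasics.
Context {R : realType}.
Implicit Types V W : normedModType R.

Lemma is_diff_eps V W (f : V -> W) (x : V) (df : {linear V -> W}) :
  continuous df ->
  (forall e : R, 0 < e ->
     \forall y \near x, `|f y - f x - df (y - x)| <= e * `|y - x|) ->
  is_diff x f df.
Proof.
move=> dfc H.
have E : f \o shift x = cst (f x) + df +o_ 0 id.
  apply/eqaddoP => e e0.
  rewrite !near_simpl; have := H _ e0; rewrite (near_shift 0 x) subr0.
  apply: filterS => h /=; rewrite addrK.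
  by rewrite -[X in _ -> `|X| <= _]/(f (h + x) - (f x + df h)) opprD addrA.
have D := diff_unique dfc E.
apply: DiffDef => //; apply/diff_locallyP; split; first by rewrite D.
by rewrite D.
Qed.

Lemma diff_eps V W (f : V -> W) (x : V) : differentiable f x ->
  forall e : R, 0 < e ->
  \forall y \near x, `|f y - f x - 'd f x (y - x)| <= e * `|y - x|.
Proof.
move=> /diff_locallyP[_ /eqaddoP D] e e0.
have := D e e0; rewrite !near_simpl (near_shift x 0) /=; apply: filterS => y /=.
rewrite -[X in `|X| <= _ -> _]/
  (f (y + (0 - x) + x) - (f x + 'd f x (y + (0 - x)))).
by rewrite sub0r subrK opprD addrA.
Qed.

Lemma near_eq_is_diff V W (f g : V -> W) (x : V) :
  (\near x, f x = g x) -> differentiable f x -> is_diff x g ('d f x).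
Proof.
move=> fg df; apply: is_diff_eps; first exact: diff_continuous.
move=> e e0; have := diff_eps df e0; rewrite (nbhs_singleton fg) => H.
by apply: filterS2 fg H => y ->.
Qed.

Lemma diff_valE V W (f df : V -> W) (x v : V) : is_diff x f df -> 'd f x v = df v.
Proof. by case=> _ ->. Qed.

(** The form in which derivatives of curves are used and produced below: all
    the estimates on flows are bounds on such remainders. *)
Lemma is_derive_epsP V (f : R -> V) (t : R) (l : V) :
  is_derive t 1 f l <->
  forall e : R, 0 < e ->
    \forall s \near t, `|f s - f t - (s - t) *: l| <= e * `|s - t|.
Proof.
split=> [D e e0|H].
  have df : differentiable f t by apply/derivable1_diffP; exact: ex_derive.
  have := diff_eps df e0; apply: filterS => s.
  suff -> : 'd f t (s - t) = (s - t) *: l by [].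
  by rewrite -[s - t in LHS]mulr1 [LHS]linearZ -deriveE// derive_val.
have [dc dl] : is_diff t f (fun h : R => h *: l).
  have lin : linear (fun h : R => h *: l : V).
    by move=> u y z; rewrite scalerDl scalerA.
  pose L : {linear R -> V} := HB.pack (fun h : R => h *: l)
    (GRing.isLinear.Build _ _ _ _ _ lin).
  apply: (@is_diff_eps _ _ f t L) => [|e /H//].
  exact: scalel_continuous.
apply: DeriveDef; first by apply/derivable1_diffP.
by rewrite deriveE// dl scale1r.
Qed.

Lemma is_derive_comp V W (g : V -> W) (y : R -> V) (t : R) (l : V) :
  differentiable g (y t) -> is_derive t 1 y l ->
  is_derive t 1 (g \o y) ('d g (y t) l).
Proof.
move=> dg dy.
have dy' : differentiable y t by apply/derivable1_diffP; exact: ex_derive.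
apply: DeriveDef.
  by apply/derivable1_diffP; exact: differentiable_comp.
rewrite deriveE; last exact: differentiable_comp.
by rewrite diff_comp//= -[in RHS](@derive_val _ _ _ _ _ _ _ dy) deriveE.
Qed.

Lemma is_derive_line V W (g : V -> W) (x w : V) (t : R) :
  differentiable g (x + t *: w) ->
  is_derive t 1 (fun h : R => g (x + h *: w)) ('d g (x + t *: w) w).
Proof.
move=> dg; apply: (@is_derive_comp _ _ g (fun h => x + h *: w)) => //.
apply/is_derive_epsP => e e0; near=> s.
rewrite opprD addrACA subrr add0r scalerBl subrr normr0.
by rewrite mulr_ge0// ltW.
Unshelve. all: by end_near. Qed.

Lemma is_diff_mx V (m n : nat) (f : V -> 'M[R]_(m, n)) (x : V) :
  (forall i j, differentiable (fun y => f y i j) x) ->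
  differentiable f x /\
  forall v, 'd f x v = \matrix_(i, j) 'd (fun y => f y i j) x v.
Proof.
move=> df.
have lin : linear
    (fun v => \matrix_(i, j) 'd (fun y => f y i j) x v : 'M[R]_(m, n)).
  by move=> k u v; apply/matrixP => i j; rewrite !mxE linearP.
pose L : {linear V -> 'M[R]_(m, n)} :=
  HB.pack (fun v => \matrix_(i, j) 'd (fun y => f y i j) x v)
    (GRing.isLinear.Build _ _ _ _ _ lin).
have [dc dl] : is_diff x f L.
  apply: is_diff_eps.
    move=> y; apply/cvgrPdist_le => e e0.
    near=> z.
    rewrite /Num.Def.normr/= mx_normrE (bigmax_le _ (ltW e0))//= => i _.
    rewrite !mxE; move: i; near: z; apply: (@filter_forall _ _ _ (nbhs y)) => /= i.
    have : {for y, continuous ('d (fun y => f y i.1 i.2) x)}.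
      by apply: diff_continuous; exact: df.
    by move=> /cvgrPdist_le /(_ e e0).
  move=> e e0; near=> y.
  rewrite {1}/Num.Def.normr/= mx_normrE bigmax_le ?mulr_ge0// ?ltW//= => i _.
  rewrite !mxE; move: i; near: y; apply: (@filter_forall _ _ _ (nbhs x)) => /= i.
  exact: diff_eps.
split=> // v; by rewrite dl.
Unshelve. all: by end_near. Qed.

Lemma differentiable_entry V (m n : nat) (f : V -> 'M[R]_(m, n)) (x : V) i j :
  differentiable f x ->
  is_diff x (fun y => f y i j) (fun v => 'd f x v i j).
Proof.
move=> df.
have -> : (fun y => f y i j) = (fun M : 'M[R]_(m, n) => M i j) \o f by [].
have lin : linear (fun M : 'M[R]_(m, n) => M i j : R).
  by move=> k u v; rewrite !mxE.
pose L : {linear 'M[R]_(m, n) -> R} := HB.pack (fun M : 'M[R]_(m, n) => M i j)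
    (GRing.isLinear.Build _ _ _ _ _ lin).
have cL : continuous L by exact: coord_continuous.
have dL y : differentiable L y by exact: linear_differentiable.
apply: DiffDef; first exact: (@differentiable_comp _ _ _ _ f L).
by rewrite (@diff_comp _ _ _ _ f L)// diff_lin.
Qed.

Lemma is_derive_entry (m n : nat) (f : R -> 'M[R]_(m, n)) (t : R) l i j :
  is_derive t 1 f l -> is_derive t 1 (fun s => f s i j) (l i j).
Proof.
move=> [df <-]; apply: DeriveDef; first by move/derivable_mxP : df; exact.
by rewrite derive_mx// mxE.
Qed.

(** Mean value inequality, in the sup norm: it suffices to apply the mean
    value theorem to each entry. *)
Lemma mean_value_ineq (n : nat) (y dy : R -> 'rV[R]_n) (a b K : R) :
  a <= b -> 0 <= K ->
  (forall s, a <= s <= b -> is_derive s 1 y (dy s) /\ `|dy s| <= K) ->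
  `|y b - y a| <= K * (b - a).
Proof.
move=> ab K0 H.
rewrite {1}/Num.Def.normr/= mx_normrE bigmax_le ?mulr_ge0 ?subr_ge0//= => i _.
have [|s|c] := @MVT_segment R (fun s => y s i.1 i.2) (fun s => dy s i.1 i.2)
  _ _ ab.
- move=> s; rewrite in_itv/= => /andP[/ltW as_ /ltW sb].
  by apply: is_derive_entry; have [|] := H s; rewrite ?as_.
- apply: derivable_within_continuous => {}s.
  rewrite in_itv/= => /andP[as_ sb].
  have [|D _] := H s; first by rewrite as_.
  by case: (is_derive_entry i.1 i.2 D).
rewrite in_itv/= => cab E; rewrite !mxE E normrM.
rewrite (ger0_norm (x := b - a)) ?subr_ge0// ler_wpM2r ?subr_ge0//.
have [_] := H c cab; apply: le_trans.
by rewrite [leRHS]/Num.Def.normr/= mx_normrE; exact: (le_bigmax _ _ i).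
Qed.

End DiffBasics.

(** * Functions of class C^k on an open set *)

Section ClassC.
Context {R : realType} {m : nat}.
Implicit Types (U : set 'rV[R]_m) (W : normedModType R).

Lemma class_C_ext W k U (f g : 'rV[R]_m -> W) : open U ->
  (forall x, U x -> f x = g x) -> class_C k U f -> class_C k U g.
Proof.
move=> oU; elim: k f g => [|k IH] f g fg /=.
  move=> cf x Ux; have fgx : \near x, f x = g x.
    by near=> y; apply: fg; near: y; exact: open_nbhs_nbhs.
  rewrite /prop_for /continuous_at -(fg _ Ux); apply: cvg_trans (cf x Ux).
  exact: (near_eq_cvg fgx).
move=> [df cf]; have fgd x : U x -> is_diff x g ('d f x).
  move=> Ux; apply: near_eq_is_diff (df x Ux).
  by near=> y; apply: fg; near: y; exact: open_nbhs_nbhs.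
split=> [x Ux|v]; first by have [] := fgd x Ux.
by apply: IH (cf v) => x Ux; exact/esym/diff_valE/fgd.
Unshelve. all: by end_near. Qed.

Lemma class_CW W k U (f : 'rV[R]_m -> W) : class_C k.+1 U f -> class_C k U f.
Proof.
elim: k f => [|k IH] f [df cf].
  by move=> x Ux; apply: differentiable_continuous; exact: df.
by split=> // v; apply: IH; exact: cf.
Qed.

Lemma class_C_cst W k U (a : W) : class_C k U (fun=> a).
Proof.
elim: k a => [|k IH] a /=; first by move=> x _; exact: cst_continuous.
split=> [x _|v]; first exact: differentiable_cst.
suff -> : (fun x => 'd (fun=> a) x v) = fun=> 0 by exact: IH.
by apply/funext => x; rewrite (diff_cst a x).
Qed.

Lemma class_CD W k U (f g : 'rV[R]_m -> W) : open U ->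
  class_C k U f -> class_C k U g -> class_C k U (fun x => f x + g x).
Proof.
move=> oU; elim: k f g => [|k IH] f g /=.
  by move=> cf cg x Ux; apply: continuousD; [exact: cf|exact: cg].
move=> [df cf] [dg cg]; split=> [x Ux|v].
  by apply: differentiableD; [exact: df|exact: dg].
apply: class_C_ext (IH _ _ (cf v) (cg v)) => // x Ux /=.
apply/esym; exact: (diff_valE v (is_diffD (differentiableP (df x Ux))
                              (differentiableP (dg x Ux)))).
Qed.

Lemma class_C_sum W k U (I : Type) (r : seq I) (P : pred I)
    (f : I -> 'rV[R]_m -> W) : open U ->
  (forall i, class_C k U (f i)) ->
  class_C k U (fun x => \sum_(i <- r | P i) f i x).
Proof.
move=> oU Cf; elim: r => [|i r IH].
  by apply: class_C_ext (@class_C_cst W k U 0) => // x _; rewrite big_nil.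
apply: (@class_C_ext _ _ _ (fun x => (if P i then f i x else 0) +
   \sum_(i <- r | P i) f i x)) => //.
  by move=> x _; rewrite big_cons; case: ifP => //; rewrite add0r.
by apply: class_CD => //; case: (P i); [exact: Cf | exact: class_C_cst].
Qed.

Lemma class_CM k U (f g : 'rV[R]_m -> R) : open U ->
  class_C k U f -> class_C k U g -> class_C k U (fun x => f x * g x).
Proof.
move=> oU; elim: k f g => [|k IH] f g.
  by move=> cf cg x Ux; apply: continuousM; [exact: cf|exact: cg].
move=> Cf Cg; have [df cf] := Cf; have [dg cg] := Cg; split=> [x Ux|v].
  by apply: differentiableM; [exact: df|exact: dg].
apply: (@class_C_ext _ _ _ (fun x => f x * 'd g x v + 'd f x v * g x)) => //.
  move=> x Ux; rewrite [X in _ + X]mulrC; apply/esym.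
  exact: (diff_valE v (is_diffM (differentiableP (df x Ux))
                                (differentiableP (dg x Ux)))).
exact: class_CD oU (IH _ _ (class_CW Cf) (cg v))
  (IH _ _ (cf v) (class_CW Cg)).
Qed.

Lemma class_C_prod k U (I : Type) (r : seq I) (P : pred I)
    (f : I -> 'rV[R]_m -> R) : open U ->
  (forall i, class_C k U (f i)) ->
  class_C k U (fun x => \prod_(i <- r | P i) f i x).
Proof.
move=> oU Cf; elim: r => [|i r IH].
  by apply: class_C_ext (@class_C_cst R k U 1) => // x _; rewrite big_nil.
apply: (@class_C_ext _ _ _ (fun x => (if P i then f i x else 1) *
   \prod_(i <- r | P i) f i x)) => //.
  by move=> x _; rewrite big_cons; case: ifP => //; rewrite mul1r.
by apply: class_CM => //; case: (P i); [exact: Cf | exact: class_C_cst].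
Qed.

Lemma class_CV k U (f : 'rV[R]_m -> R) : open U ->
  (forall x, U x -> f x != 0) ->
  class_C k U f -> class_C k U (fun x => (f x)^-1).
Proof.
move=> oU f0; elim: k => [|k IH].
  by move=> cf x Ux; apply: continuousV; [exact: f0|exact: cf].
move=> Cf; have [df cf] := Cf; split=> [x Ux|v].
  by apply: differentiableV; [exact: df|exact: f0].
apply: (@class_C_ext _ _ _
    (fun x => (- 1) * ((f x)^-1 * ((f x)^-1 * 'd f x v)))) => //.
  move=> x Ux.
  have dfV : 'd (fun y => (f y)^-1) x v = - f x ^- 2 * 'd f x v.
    exact: (congr1 (@^~ v) (diffV (df x Ux) (f0 x Ux))).
  by rewrite dfV expr2 invfM; move: (f x)^-1 ('d f x v) => a b; ring.
have CV := IH (class_CW Cf).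
have CVd := class_CM oU CV (cf v).
exact: class_CM oU (class_C_cst _ _ _) (class_CM oU CV CVd).
Qed.

Lemma class_C_mx k U (p q : nat) (f : 'rV[R]_m -> 'M[R]_(p, q)) : open U ->
  (forall i j, class_C k U (fun x => f x i j)) -> class_C k U f.
Proof.
move=> oU; elim: k f => [|k IH] f Cf.
  move=> x Ux; apply/(@cvgrPdist_le _ _ _ (nbhs x) _ f (f x)) => e e0.
  have : \forall y \near x, forall i : 'I_p * 'I_q,
      `|f x i.1 i.2 - f y i.1 i.2| <= e.
    apply: (@filter_forall _ _ _ _ (nbhs_filter x)) => i.
    by have /cvgrPdist_le /(_ e e0) := Cf i.1 i.2 x Ux.
  apply: (@filterS _ _ (nbhs_filter x)) => y fxy.
  rewrite /Num.Def.normr/= mx_normrE (bigmax_le _ (ltW e0))//= => i _.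
  by rewrite !mxE.
have df x : U x -> _ := fun Ux => is_diff_mx (fun i j => (Cf i j).1 x Ux).
split=> [x Ux|v]; first by have [] := df x Ux.
apply: IH => i j; apply: class_C_ext ((Cf i j).2 v) => // x Ux.
by have [_ ->] := df x Ux; rewrite mxE.
Qed.

Lemma class_C_entry k U (p q : nat) (f : 'rV[R]_m -> 'M[R]_(p, q)) i j :
  open U -> class_C k U f -> class_C k U (fun x => f x i j).
Proof.
move=> oU; elim: k f => [|k IH] f.
  move=> Cf x Ux.
  exact: (@continuous_comp _ _ _ f (fun M : 'M[R]_(p, q) => M i j) x (Cf x Ux)
    (@coord_continuous R p q i j _)).
move=> [df Cf]; split=> [x Ux|v].
  by have [] := differentiable_entry i j (df x Ux).
apply: class_C_ext (IH _ (Cf v)) => // x Ux.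
by have [_ ->] := differentiable_entry i j (df x Ux).
Qed.

Lemma class_C_mulmx k U (p q r : nat) (A : 'rV[R]_m -> 'M[R]_(p, q))
    (B : 'rV[R]_m -> 'M[R]_(q, r)) : open U ->
  class_C k U A -> class_C k U B -> class_C k U (fun x => A x *m B x).
Proof.
move=> oU CA CB; apply: class_C_mx => // i j.
apply: (@class_C_ext _ _ _ (fun x => \sum_l A x i l * B x l j)) => //.
  by move=> x _; rewrite mxE.
by apply: class_C_sum => // l; apply: class_CM => //; exact: class_C_entry.
Qed.

(** The determinant is a polynomial in the entries. *)
Lemma class_C_det k U (p : nat) (A : 'rV[R]_m -> 'M[R]_p) : open U ->
  class_C k U A -> class_C k U (fun x => \det (A x)).
Proof.
move=> oU CA; rewrite /determinant; apply: class_C_sum => // s.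
apply: class_CM => //; first exact: class_C_cst.
by apply: class_C_prod => // i; exact: class_C_entry.
Qed.

(** Cramer's rule expresses the entries of the inverse as rational functions
    of those of the matrix. *)
Lemma class_C_invmx k U (p : nat) (A : 'rV[R]_m -> 'M[R]_p) : open U ->
  (forall x, U x -> A x \in unitmx) ->
  class_C k U A -> class_C k U (fun x => invmx (A x)).
Proof.
move=> oU uA CA; apply: class_C_mx => // i j.
apply: (@class_C_ext _ _ _ (fun x => (\det (A x))^-1 *
   ((-1) ^+ (j + i) * \det (row' j (col' i (A x)))))) => //.
  by move=> x Ux; rewrite /invmx uA// !mxE.
apply: class_CM => //.
  apply: class_CV => //; last exact: class_C_det.
  by move=> x /uA; rewrite unitmxE unitfE.
apply: class_CM => //; first exact: class_C_cst.
apply: class_C_det => //; apply: class_C_mx => // a b.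
apply: class_C_ext (class_C_entry (lift j a) (lift i b) oU CA) => // x _.
by rewrite !mxE.
Qed.

End ClassC.

(** * Local bounds and Gronwall's lemma *)

Section LocalBounds.
Context {R : realType} {m : nat}.
Implicit Types (U : set 'rV[R]_m) (W : normedModType R).

Lemma norm_entry_le (p q : nat) (A : 'M[R]_(p, q)) i j : `|A i j| <= `|A|.
Proof.
by rewrite [leRHS]/Num.Def.normr/= mx_normrE; exact: (le_bigmax _ _ (i, j)).
Qed.

Lemma linear_row_sum (V : lmodType R) (f : {linear 'rV[R]_m -> V}) v :
  f v = \sum_j v 0 j *: f (delta_mx 0 j).
Proof.
rewrite {1}(row_sum_delta v) linear_sum.
by apply: eq_bigr => j _; rewrite linearZ.
Qed.

Lemma linear_bound W (f : {linear 'rV[R]_m -> W}) (K : 'I_m -> R) v :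
  (forall j, `|f (delta_mx 0 j)| <= K j) -> `|f v| <= (\sum_j K j) * `|v|.
Proof.
move=> fK; rewrite linear_row_sum.
apply: le_trans (ler_norm_sum _ _ _) _; rewrite mulr_suml.
apply: ler_sum => j _; rewrite normrZ mulrC.
by apply: ler_pM => //; exact: norm_entry_le.
Qed.

(** Finitely many directional derivatives control the operator norm of the
    differential, and each of them is continuous; adding 1 to its value at
    [x0] bounds it near [x0]. *)
Lemma class_C1_bounded W U (g : 'rV[R]_m -> W) (x0 : 'rV[R]_m) :
  open U -> U x0 -> class_C 1 U g ->
  \forall x \near x0, U x /\
    forall v, `|'d g x v| <= (\sum_j (`|'d g x0 (delta_mx 0 j)| + 1)) * `|v|.
Proof.
move=> oU Ux0 [dg cg].
have nU : \forall x \near x0, U x by apply: open_nbhs_nbhs.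
have nd : \forall x \near x0, forall j : 'I_m,
    `|'d g x (delta_mx 0 j)| <= `|'d g x0 (delta_mx 0 j)| + 1.
  apply: (@filter_forall _ _ _ _ (nbhs_filter x0)) => j.
  have /(@cvgrPdist_le _ _ _ (nbhs x0)) /(_ 1 ltr01) := cg (delta_mx 0 j) x0 Ux0.
  apply: (@filterS _ _ (nbhs_filter x0)) => x xd.
  rewrite addrC -lerBlDr; apply: le_trans xd; rewrite distrC.
  exact: lerB_dist.
by apply: (@filterS2 _ _ (nbhs_filter x0) _ _ _ _ nU nd) => x Ux H; split=> // v;
   exact: linear_bound.
Qed.

Lemma near_normP (x0 : 'rV[R]_m) (P : set 'rV[R]_m) :
  (\forall x \near x0, P x) <->
  exists r : R, 0 < r /\ forall x, `|x - x0| < r -> P x.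
Proof.
split=> [/nbhs_ballP[r r0 H]|[r [r0 H]]].
  by exists r; split=> // x xr; apply: H; rewrite -ball_normE/= distrC.
by apply/nbhs_ballP; exists r => // x; rewrite -ball_normE/= distrC; exact: H.
Qed.

Lemma segment_in_ball (x0 x y : 'rV[R]_m) (r t : R) :
  `|x - x0| < r -> `|y - x0| < r -> 0 <= t <= 1 ->
  `|x + t *: (y - x) - x0| < r.
Proof.
move=> xr yr /andP[t0 t1].
have -> : x + t *: (y - x) - x0 = (1 - t) *: (x - x0) + t *: (y - x0).
  by apply/rowP => i; rewrite !mxE; ring.
apply: le_lt_trans (ler_normD _ _) _; rewrite !normrZ (ger0_norm t0).
rewrite ger0_norm ?subr_ge0//.
have [->|tn0] := eqVneq t 0; first by rewrite subr0 mul1r mul0r addr0.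
have h1 : (1 - t) * `|x - x0| <= (1 - t) * r.
  by rewrite ler_wpM2l ?subr_ge0// ltW.
have h2 : t * `|y - x0| < t * r by rewrite ltr_pM2l// lt0r tn0.
move: h1 h2; rewrite mulrBl mul1r; lra.
Qed.

Lemma lipschitz_ball (n : nat) (g : 'rV[R]_m -> 'rV[R]_n) (x0 : 'rV[R]_m)
    (r L : R) : 0 <= L ->
  (forall x, `|x - x0| < r -> differentiable g x) ->
  (forall x, `|x - x0| < r -> forall v, `|'d g x v| <= L * `|v|) ->
  forall x y, `|x - x0| < r -> `|y - x0| < r -> `|g y - g x| <= L * `|y - x|.
Proof.
move=> L0 dg gL x y xr yr.
have := @mean_value_ineq R n (fun t => g (x + t *: (y - x)))
  (fun t => 'd g (x + t *: (y - x)) (y - x)) 0 1 (L * `|y - x|) ler01.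
rewrite scale0r scale1r addr0 (addrC x) subrK subr0 mulr1; apply.
  by rewrite mulr_ge0.
move=> t t01; have B := segment_in_ball xr yr t01.
by split; [apply: is_derive_line; exact: dg | exact: gL].
Qed.

(** The constants are uniform on a ball, so that the first- and second-order
    estimates may be used along a whole piece of curve. *)
Lemma class_C2_taylor (n : nat) U (g : 'rV[R]_m -> 'rV[R]_n) (x0 : 'rV[R]_m) :
  open U -> U x0 -> class_C 2 U g ->
  exists r L C : R, [/\ 0 < r, 0 <= L, 0 <= C,
    forall x, `|x - x0| < r -> U x /\ forall v, `|'d g x v| <= L * `|v| &
    forall x y, `|x - x0| < r -> `|y - x0| < r ->
      `|g y - g x| <= L * `|y - x| /\
      `|g y - g x - 'd g x (y - x)| <= C * `|y - x| ^+ 2].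
Proof.
move=> oU Ux0 Cg; have [dg cg] := Cg.
pose L := \sum_j (`|'d g x0 (delta_mx 0 j)| + 1).
pose h j x := 'd g x (delta_mx 0 j).
pose K j := \sum_i (`|'d (h j) x0 (delta_mx 0 i)| + 1).
have K0 j : 0 <= K j by rewrite sumr_ge0// => i _; rewrite addr_ge0.
have N1 := class_C1_bounded oU Ux0 (class_CW Cg).
have N2 : \forall x \near x0, forall j : 'I_m, U x /\
    forall v, `|'d (h j) x v| <= K j * `|v|.
  apply: (@filter_forall _ _ _ _ (nbhs_filter x0)) => j.
  exact: class_C1_bounded oU Ux0 (cg _).
have [r [r0 H]] := (near_normP _ _).1 (@filterI _ _ (nbhs_filter x0) _ _ N1 N2).
have L0 : 0 <= L by rewrite /L sumr_ge0// => j _; rewrite addr_ge0.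
have dgr x : `|x - x0| < r -> differentiable g x.
  by move=> /H[[Ux _] _]; exact: dg.
exists r, L, (\sum_j K j); split => //.
- by apply: sumr_ge0 => j _; exact: K0.
- by move=> x /H[].
move=> x y xr yr; split.
  by apply: (@lipschitz_ball n g x0 r) => // z /H[[]].
set w := y - x.
(* First-order remainder along the segment from x to y: its derivative is a
   variation of the differential, which is Lipschitz. *)
have := @mean_value_ineq R n (fun t => g (x + t *: w) - t *: 'd g x w)
  (fun t => 'd g (x + t *: w) w - 'd g x w) 0 1 ((\sum_j K j) * `|w| ^+ 2) ler01.
rewrite !scale0r !scale1r addr0 subr0 subr0 mulr1 /w (addrC x) subrK.
rewrite [_ - 'd g x _ - _]addrAC; apply.
  by apply: mulr_ge0; [apply: sumr_ge0 => j _; exact: K0 | exact: sqr_ge0].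
move=> t t01; have B := segment_in_ball xr yr t01; rewrite -/w in B *; split.
  apply: is_deriveB; first by apply: is_derive_line; exact: dgr.
  apply/is_derive_epsP => e e0; near=> s.
  by rewrite scalerBl subrr normr0 mulr_ge0// ltW.
have -> : 'd g (x + t *: w) w - 'd g x w =
    \sum_j w 0 j *: (h j (x + t *: w) - h j x).
  have E1 := linear_row_sum ('d g (x + t *: w)) w.
  have E2 := linear_row_sum ('d g x) w.
  apply: etrans (congr2 (fun a b => a - b) E1 E2) _.
  by rewrite -sumrB; apply: eq_bigr => j _; rewrite -scalerBr.
apply: le_trans (ler_norm_sum _ _ _) _; rewrite mulr_suml.
apply: ler_sum => j _; rewrite normrZ expr2 mulrCA ler_pM ?norm_entry_le//.
have dh z : `|z - x0| < r -> differentiable (h j) z.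
  by move=> /H[[Uz _] _]; exact: (cg _).1.
have bh z : `|z - x0| < r -> forall v, `|'d (h j) z v| <= K j * `|v|.
  by move=> /H[_ /(_ j)[]].
have LB := @lipschitz_ball n (h j) x0 r (K j) (K0 j) dh bh x (x + t *: w) xr B.
apply: le_trans LB _; rewrite (addrC x) addrK; apply: ler_wpM2l; first exact: K0.
by rewrite normrZ ler_piMl//; case/andP: t01 => t0 t1; rewrite ger0_norm.
Unshelve. all: by end_near. Qed.

End LocalBounds.

Section Gronwall.
Context {R : realType} {n : nat}.

(** A weak form of the lemma of Gronwall, on intervals so short that the
    growth factor [expR (L * (b - a))] may be replaced by 2: bound [phi s] by
    the maximum of [`|phi|] and absorb the latter.  It holds in both
    directions of time. *)
Lemma short_gronwall (phi dphi : R -> 'rV[R]_n) (a b L k : R) :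
  0 <= L -> 0 <= k -> (b - a) * L <= 2^-1 ->
  (forall s, a <= s <= b ->
     is_derive s 1 phi (dphi s) /\ `|dphi s| <= L * `|phi s| + k) ->
  forall s s1, a <= s <= b -> a <= s1 <= b ->
    `|phi s| <= 2 * `|phi s1| + 2 * (b - a) * k.
Proof.
move=> L0 k0 abL H s s1 sab s1ab.
have ab : a <= b by have /andP[] := sab; exact: le_trans.
have cphi : {within `[a, b], continuous (fun t => `|phi t|)}.
  apply: continuous_in_subspaceT => t; rewrite inE/= in_itv/= => /H[D _].
  have cp : {for t, continuous phi}.
    by apply: differentiable_continuous; apply/derivable1_diffP; case: D.
  exact: (continuous_comp cp (@norm_continuous _ _ (phi t))).
have [c cab cmax] := EVT_max ab cphi.
rewrite in_itv/= in cab.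
have sle : `|phi s| <= `|phi c| by apply: cmax; rewrite in_itv.
have K0 : 0 <= L * `|phi c| + k by rewrite addr_ge0// mulr_ge0.
have ba0 : 0 <= b - a by rewrite subr_ge0.
have var u v : a <= u -> u <= v -> v <= b ->
    `|phi v - phi u| <= (L * `|phi c| + k) * (b - a).
  move=> au uv vb; apply: (@le_trans _ _ ((L * `|phi c| + k) * (v - u))).
    apply: (@mean_value_ineq R n phi dphi) => // t /andP[ut tv].
    have tab : a <= t <= b by rewrite (le_trans au)// (le_trans tv).
    have [D le] := H t tab; split=> //; apply: le_trans le _.
    by rewrite lerD2r ler_wpM2l// cmax// in_itv.
  by rewrite ler_wpM2l// lerB.
have {var} : `|phi c - phi s1| <= (L * `|phi c| + k) * (b - a).
  move: cab s1ab => /andP[ac cb] /andP[as1 s1b].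
  by have [/var|/ltW/var] := leP c s1; [rewrite distrC|]; apply.
move=> var; have := lerB_dist (phi c) (phi s1) => tri.
have : L * `|phi c| * (b - a) <= 2^-1 * `|phi c|.
  by rewrite mulrAC (mulrC L) ler_wpM2r.
rewrite mulrDl in var; have -> : 2 * (b - a) * k = 2 * (k * (b - a)) by ring.
move: tri var sle; move: (L * `|phi c| * (b - a)) (k * (b - a)) => A B.
by lra.
Qed.

End Gronwall.

(** * Continuity induction and curves in charts *)

Section Induction.
Context {R : realType}.

Lemma is_derive_affine (V : normedModType R) (y : R -> V) (a k t : R) (l : V) :
  is_derive (a + t * k) 1 y l ->
  is_derive t 1 (fun h => y (a + h * k)) (k *: l).
Proof.
move=> D; have dy : differentiable y (a + t * k).
  by apply/derivable1_diffP; case: D.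
have -> : k *: l = 'd y (a + t * k) k.
  move: (a + t * k) D dy => u D dy.
  by rewrite -[k in RHS]mulr1 [RHS]linearZ -deriveE// derive_val.
exact: (@is_derive_line R R V y a k t).
Qed.

Lemma near_norm_lt (T : topologicalType) (V : normedModType R) (f : T -> V)
    (t : T) (x0 : V) (r : R) :
  {for t, continuous f} -> `|f t - x0| < r -> \forall s \near t, `|f s - x0| < r.
Proof.
move=> cf fr; have : `|f s - x0| @[s --> t] --> `|f t - x0|.
  by apply: cvg_norm; apply: cvgB => //; exact: cvg_cst.
by move=> /cvgr_lt; apply.
Qed.

(** Continuity induction: the supremum of the initial segments on which [P]
    holds belongs to them by the second hypothesis, and is 1 by the third. *)
Lemma unit_interval_ind (P : R -> Prop) :
  P 0 ->
  (forall t, 0 < t <= 1 -> (forall s, 0 <= s < t -> P s) -> P t) ->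
  (forall t, 0 <= t < 1 -> (forall s, 0 <= s <= t -> P s) ->
     exists d, 0 < d /\ forall s, t < s < t + d -> s <= 1 -> P s) ->
  forall t, 0 <= t <= 1 -> P t.
Proof.
move=> P0 Pl Pr.
pose E := [set t : R | 0 <= t <= 1 /\ forall s, 0 <= s <= t -> P s].
have E0 : E 0.
  split=> [|s /andP[s0 s0']]; first by rewrite lexx ler01.
  by have -> : s = 0 by apply/eqP; rewrite eq_le s0 s0'.
have supE : has_sup E.
  by split; [exists 0 | exists 1 => t [/andP[]]].
set u := sup E.
have u0 : 0 <= u by apply: sup_upper_bound.
have u1 : u <= 1 by apply: ge_sup; [exists 0 | move=> t [/andP[]]].
have below s : 0 <= s < u -> P s.
  move=> /andP[s0 su].
  have /(sup_adherent)/(_ supE) : 0 < u - s by rewrite subr_gt0.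
  move=> [t [t01 Ht]]; rewrite -/u opprB addrC subrK => st.
  by apply: Ht; rewrite s0 ltW.
have Pu : P u.
  have [->//|un0] := eqVneq u 0.
  by apply: Pl => //; rewrite lt0r un0 u0.
have upto s : 0 <= s <= u -> P s.
  move=> /andP[s0]; rewrite le_eqVlt => /orP[/eqP->//|su].
  by apply: below; rewrite s0.
have u1' : u = 1.
  apply/eqP; rewrite eq_le u1 leNgt; apply/negP => ult.
  have u01 : 0 <= u < 1 by rewrite u0.
  have [d [d0 Hd]] := Pr u u01 upto.
  pose v := Num.min 1 (u + d / 2).
  have uv : u < v by rewrite /v lt_min ult ltrDl divr_gt0.
  have Ev : E v.
    split=> [|s /andP[s0 sv]].
      by rewrite (le_trans u0 (ltW uv))/= /v ge_min lexx.
    have [su|us] := leP s u; first by apply: upto; rewrite s0.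
    move: sv; rewrite /v le_min => /andP[s1 sud]; apply: Hd => //.
    rewrite us (le_lt_trans sud)// ltrD2l; lra.
  by have := sup_upper_bound supE Ev; rewrite leNgt uv.
by move=> t; rewrite -u1'; exact: upto.
Qed.

End Induction.

Section Charts.
Context {R : realType} {m : nat} (M : manifold R m).
Implicit Types (c : mindex M) (p : M).

Definition cod c : set 'rV[R]_m := coord c @` dom c.

Lemma open_dom c : open (dom c). Proof. exact: chart_dom_open. Qed.

Lemma open_cod c : open (cod c). Proof. exact: chart_cod_open. Qed.

Lemma coordK c p : dom c p -> param c (coord c p) = p.
Proof. exact: chart_funK. Qed.

Lemma cod_coord c p : dom c p -> cod c (coord c p).
Proof. by exists p. Qed.

Lemma dom_param c x : cod c x -> dom c (param c x).
Proof. by move=> [p cp <-]; rewrite coordK. Qed.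

Lemma paramK c x : cod c x -> coord c (param c x) = x.
Proof. by move=> [p cp <-]; rewrite coordK. Qed.

Lemma continuous_coord c p : dom c p -> {for p, continuous (coord c)}.
Proof. exact: chart_fun_continuous. Qed.

Lemma continuous_param c x : cod c x -> {for x, continuous (param c)}.
Proof. exact: chart_inv_continuous. Qed.

Lemma near_dom c p : dom c p -> \forall q \near p, dom c q.
Proof. by move=> cp; apply: open_nbhs_nbhs; split=> //; exact: open_dom. Qed.

Lemma near_cod c x : cod c x -> \forall y \near x, cod c y.
Proof. by move=> cp; apply: open_nbhs_nbhs; split=> //; exact: open_cod. Qed.

(** Closed balls of a chart are compact, hence closed in [M] by the Hausdorff
    property. *)
Lemma closed_chart_ball c (x0 : 'rV[R]_m) (r : R) :
  (forall x, `|x - x0| <= r -> cod c x) ->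
  closed (param c @` [set x | `|x - x0| <= r]).
Proof.
move=> rc; apply: compact_closed; first exact: manifold_hausdorff.
apply: continuous_compact.
  apply: continuous_in_subspaceT => x; rewrite inE/= => /rc.
  exact: continuous_param.
apply: bounded_closed_compact.
  exists (r + `|x0|); split; first exact: num_real.
  move=> K rK x /= xr; apply: ltW; apply: le_lt_trans rK.
  by rewrite -[x in leLHS](subrK x0) (le_trans (ler_normD _ _))// lerD2r.
have -> : [set x | `|x - x0| <= r] = closed_ball_ (@Num.norm R _) x0 r.
  by apply/seteqP; split=> x /=; rewrite /closed_ball_/= distrC.
exact: closed_closed_ball_.
Qed.

(** A curve of bounded speed cannot leave a ball of a chart too early: while it
    is in the ball it stays in a smaller closed ball, which is closed in [M]. *)
Lemma stay_in_chart (X : vfield M) (gamma : R -> M) c (x0 : 'rV[R]_m)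
    (r rho B s1 s2 : R) :
  integral_curve X gamma -> 0 <= B ->
  (forall x, `|x - x0| < r -> cod c x) ->
  (forall p, dom c p -> `|coord c p - x0| < r -> `|X c p| <= B) ->
  dom c (gamma s1) -> `|coord c (gamma s1) - x0| <= rho ->
  rho + B * `|s2 - s1| < r ->
  dom c (gamma s2) /\ `|coord c (gamma s2) - x0| <= rho + B * `|s2 - s1|.
Proof.
move=> [cg dg] B0 rc XB cs1 s1rho rhor.
set k := s2 - s1; set rr := rho + B * `|k|.
(* Running from s1 to s2 in unit time treats both directions of time alike. *)
pose eta t := gamma (s1 + t * k).
have ceta : continuous eta.
  move=> t; have ct : {for t, continuous (fun h : R => s1 + h * k)}.
    apply: continuousD; first exact: cst_continuous.
    by apply: continuousM => //; exact: cst_continuous.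
  exact: (continuous_comp ct (cg (s1 + t * k))).
pose C := param c @` [set x | `|x - x0| <= rr].
have clC : closed C.
  by apply: closed_chart_ball => x xr; apply: rc; exact: le_lt_trans rhor.
have CP p : C p -> dom c p /\ `|coord c p - x0| <= rr.
  move=> [x /= xr <-]; have cx : cod c x by apply: rc; exact: le_lt_trans rhor.
  by rewrite paramK//; split=> //; exact: dom_param.
have PC p : dom c p -> `|coord c p - x0| <= rr -> C p.
  by move=> cp pr; exists (coord c p) => //; exact: coordK.
suff : C (eta 1) by rewrite /eta mul1r /k addrC subrK => /CP.
apply: (@unit_interval_ind R (fun t => C (eta t))); last by rewrite ler01 lexx.
- rewrite /eta mul0r addr0; apply: PC => //; apply: le_trans s1rho _.
  by rewrite lerDl mulr_ge0.
- move=> t /andP[t0 t1] H; apply: contrapT => nC.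
  have /nbhs_ballP[e /= e0 He] : \forall s \near t, (~` C) (eta s).
    apply: (ceta t); apply: open_nbhs_nbhs; split=> //.
    by rewrite openC.
  pose s := Num.max 0 (t - e / 2).
  have st : s < t by rewrite /s gt_max t0/= ltrBlDr ltrDl divr_gt0.
  have s0 : 0 <= s by rewrite /s le_max lexx.
  have : (~` C) (eta s).
    apply: He; rewrite -ball_normE/= gtr0_norm ?subr_gt0//.
    by have : t - e / 2 <= s by [rewrite /s le_max lexx orbT]; lra.
  by apply; apply: H; rewrite s0.
- move=> t /andP[t0 t1] H.
  have Ct : C (eta t) by apply: H; rewrite t0 lexx.
  have [ct tr] := CP _ Ct; have tr' := le_lt_trans tr rhor.
  have /nbhs_ballP[e /= e0 He] : \forall s \near t,
      dom c (eta s) /\ `|coord c (eta s) - x0| < r.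
    have n1 : \forall s \near t, dom c (eta s) by apply: (ceta t); exact: near_dom.
    have n2 : \forall s \near t, `|coord c (eta s) - x0| < r.
      have cc := continuous_comp (ceta t) (continuous_coord ct).
      exact: near_norm_lt cc tr'.
    by apply: filterS2 n1 n2.
  exists e; split=> // s /andP[ts ste] s1'.
  have inr u : 0 <= u <= s -> dom c (eta u) /\ `|coord c (eta u) - x0| < r.
    move=> /andP[u0 us]; have [ut|tu] := leP u t.
      have [] := CP _ (H u _); first by rewrite u0.
      by move=> cu ur; split=> //; exact: le_lt_trans rhor.
    apply: He; rewrite -ball_normE/= distrC gtr0_norm ?subr_gt0//; lra.
  have [cs _] : dom c (eta s) /\ `|coord c (eta s) - x0| < r.
    by apply: inr; rewrite lexx (le_trans t0 (ltW ts)).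
  apply: PC => //.
  have := @mean_value_ineq R m (coord c \o eta) (fun u => k *: X c (eta u)) 0 s
    (`|k| * B).
  have s0 : 0 <= s by rewrite (le_trans t0 (ltW ts)).
  have kB : 0 <= `|k| * B by rewrite mulr_ge0.
  move=> /(_ s0 kB) MV.
  have {MV} MV : `|coord c (eta s) - coord c (eta 0)| <= `|k| * B * (s - 0).
    apply: MV => u us; have [cu ur] := inr u us; split.
      by apply: (@is_derive_affine R _ (coord c \o gamma) s1 k u); exact: dg.
    by rewrite normrZ ler_wpM2l// XB.
  have E0 : eta 0 = gamma s1 by rewrite /eta mul0r addr0.
  rewrite E0 subr0 in MV.
  rewrite -(subrKA (coord c (gamma s1))) (le_trans (ler_normD _ _))// addrC.
  rewrite lerD//; apply: le_trans MV _; rewrite (mulrC B); apply: ler_piMr => //.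
Qed.

End Charts.

(** * Commuting vector fields *)

Section CommutingFlows.
Context {R : realType} {m : nat} (M : manifold R m).
Implicit Types (c : mindex M) (p : M).

Lemma is_derive_chart (eta : R -> M) (t : R) c c' (l : 'rV[R]_m) :
  {for t, continuous eta} -> dom c (eta t) -> dom c' (eta t) ->
  is_derive t 1 (coord c \o eta) l ->
  is_derive t 1 (coord c' \o eta)
    ('d (transition (mchart c) (mchart c')) (coord c (eta t)) l).
Proof.
move=> ceta ct ct' D.
have dtau : differentiable (transition (mchart c) (mchart c')) (coord c (eta t)).
  by have [+ _] := @manifold_compat _ _ M c c' 1; apply; exists (eta t).
have := is_derive_comp dtau D; apply: near_eq_is_derive.
have : \forall s \near t, dom c (eta s) by apply: ceta; exact: near_dom.
by apply: filterS => s cs; rewrite /= /transition /= chart_funK.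
Qed.

(** [Gamma s t] stands for the flow of [Y] at time [s] applied to the point
    [Gamma 0 t] of an integral curve of [Z]; the curves [Gamma^~ t] are chosen
    separately, so that regularity in [t] is what has to be proved. *)
Variables (Y Z : vfield M) (Gamma : R -> R -> M).
Let loc (X : vfield M) c (x : 'rV[R]_m) := X c (param c x).

Hypothesis smooth_Y : forall c, class_C 2 (cod c) (loc Y c).
Hypothesis smooth_Z : forall c, class_C 1 (cod c) (loc Z c).
Hypothesis bracket0 : forall c x, cod c x ->
  'd (loc Y c) x (loc Z c x) = 'd (loc Z c) x (loc Y c x).
Hypothesis tensor_Z : forall c c' p, dom c p -> dom c' p ->
  Z c' p = 'd (transition (mchart c) (mchart c')) (coord c p) (Z c p).
Hypothesis curve_Y : forall t, integral_curve Y (Gamma^~ t).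

Let transported (s t : R) :=
  {for t, continuous (Gamma s)} /\
  forall c, dom c (Gamma s t) ->
    is_derive t 1 (coord c \o Gamma s) (Z c (Gamma s t)).

(** In a chart, write [x] and [y] for the curves [Gamma^~ t0] and [Gamma^~ t],
    and [h] for [t - t0].  Gronwall's lemma for [y - x] bounds it by a constant
    times [h].  The defect [D = y - x - h Z(x)] satisfies
      [D' = Y(y) - Y(x) - h DZ(x)Y(x) = (Y(y) - Y(x) - DY(x)(y - x)) + DY(x)D]
    because [DZ(x)Y(x) = DY(x)Z(x)]; the first summand is quadratic in [h], and
    so, again by Gronwall's lemma, [D = o(h)] at one time [s1] of the window
    implies [D = o(h)] at all of them. *)
Lemma transported_window c (s0 t0 : R) : dom c (Gamma s0 t0) ->
  exists e : R, 0 < e /\ forall s1, `|s1 - s0| <= e -> transported s1 t0 ->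
    exists C : R,
    (\forall t \near t0, forall s, `|s - s0| <= e ->
       dom c (Gamma s t) /\
       `|coord c (Gamma s t) - coord c (Gamma s t0)| <= C * `|t - t0|) /\
    forall s, `|s - s0| <= e -> transported s t0.
Proof.
move=> c0; set x0 := coord c (Gamma s0 t0).
have Ux0 : cod c x0 by exact: cod_coord.
have [r [L [Q [r0 L0 Q0 Ur taylor]]]] :=
  class_C2_taylor (@open_cod _ _ M c) Ux0 (smooth_Y c).
pose B := `|loc Y c x0| + L * r.
have B0 : 0 <= B by rewrite addr_ge0// mulr_ge0// ltW.
have YB p : dom c p -> `|coord c p - x0| < r -> `|Y c p| <= B.
  move=> cp pr; rewrite -[X in Y c X](coordK cp) -/(loc Y c (coord c p)).
  rewrite -(subrK (loc Y c x0) (loc Y c _)) (le_trans (ler_normD _ _))// addrC.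
  rewrite lerD2l; have x0r : `|x0 - x0| < r by rewrite subrr normr0.
  have [le1 _] := taylor _ _ x0r pr; apply: le_trans le1 _.
  by rewrite ler_wpM2l// ltW.
have cod_r x : `|x - x0| < r -> cod c x by move=> /Ur[].
(* The window is short enough for short_gronwall, and for curves of speed at
   most B that start within r / 2 of x0 to stay within r of x0. *)
pose e := Num.min (4 * (L + 1))^-1 (r / (8 * (B + 1))).
have e0 : 0 < e.
  rewrite /e lt_min invr_gt0 mulr_gt0 ?ltr_wpDl//= divr_gt0// mulr_gt0//.
  by rewrite ltr_wpDl.
have eL : (s0 + e - (s0 - e)) * L <= 2^-1.
  have : e <= (4 * (L + 1))^-1 by rewrite /e ge_min lexx.
  rewrite -div1r ler_pdivlMr ?mulr_gt0 ?ltr_wpDl//.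
  have : 0 <= e * L by rewrite mulr_ge0// ltW.
  nra.
have eB : B * e <= r / 8.
  have : e <= r / (8 * (B + 1)) by rewrite /e ge_min lexx orbT.
  rewrite ler_pdivlMr ?mulr_gt0 ?ltr_wpDl//.
  have : 0 <= e * B by rewrite mulr_ge0// ltW.
  nra.
pose win s := `|s - s0| <= e.
have winE s : s0 - e <= s <= s0 + e -> win s.
  by move=> H; rewrite /win ler_norml; lra.
have winP s : win s -> s0 - e <= s <= s0 + e.
  by rewrite /win ler_norml; lra.
have win2 s s' : win s -> win s' -> `|s - s'| <= 2 * e.
  by move=> /winP ? /winP ?; rewrite ler_norml; lra.
pose x s := coord c (Gamma s t0).
have xr s : win s -> dom c (Gamma s t0) /\ `|x s - x0| < r.
  move=> ws; have le1 : B * `|s - s0| <= r / 8.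
    by apply: le_trans eB; rewrite ler_wpM2l.
  have := @stay_in_chart R m M Y (Gamma^~ t0) c x0 r 0 B s0 s (curve_Y t0) B0
    cod_r YB c0.
  rewrite -/x0 subrr normr0 add0r => /(_ (lexx _)) [|cs le2].
    lra.
  split=> //; apply: (le_lt_trans le2); lra.
exists e; split=> // s1 ws1 [cont1 der1].
have [cs1 xs1] := xr _ ws1.
have xs1' : `|x s1 - x0| < r / 2.
  have le1 : B * `|s1 - s0| <= r / 8.
    by apply: le_trans eB; rewrite ler_wpM2l.
  have := @stay_in_chart R m M Y (Gamma^~ t0) c x0 r 0 B s0 s1 (curve_Y t0) B0
    cod_r YB c0.
  rewrite -/x0 subrr normr0 add0r => /(_ (lexx _)) [|_ le2].
    lra.
  apply: (le_lt_trans le2); lra.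
have near1 : \forall t \near t0, forall s, win s ->
    dom c (Gamma s t) /\ `|coord c (Gamma s t) - x0| < r.
  have n1 : \forall t \near t0, dom c (Gamma s1 t) by apply: cont1; exact: near_dom.
  have n2 : \forall t \near t0, `|coord c (Gamma s1 t) - x0| < r / 2.
    have cc := continuous_comp cont1 (continuous_coord cs1).
    exact: near_norm_lt cc xs1'.
  apply: filterS2 n1 n2 => t ct tr s ws.
  have le1 : B * `|s - s1| <= r / 4.
    apply: (@le_trans _ _ (B * (2 * e))); last lra.
    by rewrite ler_wpM2l// win2.
  have := @stay_in_chart R m M Y (Gamma^~ t) c x0 r (r / 2) B s1 s (curve_Y t) B0
    cod_r YB ct (ltW tr).
  case=> [|cs le2]; first lra.
  split=> //; apply: (le_lt_trans le2); lra.
have dcurve s t : dom c (Gamma s t) ->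
    is_derive s 1 (fun s => coord c (Gamma s t)) (loc Y c (coord c (Gamma s t))).
  by move=> cst; rewrite /loc coordK//; exact: (curve_Y t).2.
pose z := Z c (Gamma s1 t0); pose C := 2 * (`|z| + 1).
have D1 := (is_derive_epsP _ _ _).1 (der1 c cs1).
have near2 : \forall t \near t0, forall s, win s ->
    dom c (Gamma s t) /\ `|coord c (Gamma s t) - x s| <= C * `|t - t0|.
  have n2 := D1 1 ltr01; apply: filterS2 near1 n2 => t H h1 s ws.
  split; first by have [] := H s ws.
  have G := @short_gronwall R m (fun s => coord c (Gamma s t) - x s)
    (fun s => loc Y c (coord c (Gamma s t)) - loc Y c (x s))
    (s0 - e) (s0 + e) L 0 L0 (lexx _) eL.
  have {}G : `|coord c (Gamma s t) - x s| <=
      2 * `|coord c (Gamma s1 t) - x s1| + 2 * (s0 + e - (s0 - e)) * 0.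
    apply: G; [|exact: winP..] => u /winE wu; have [cu ur] := H u wu.
    have [cu0 ur0] := xr u wu; split.
      by apply: is_deriveB; exact: dcurve.
    by rewrite addr0; have [] := taylor _ _ ur0 ur.
  apply: le_trans G _; rewrite mulr0 addr0 /C -mulrA ler_wpM2l//.
  rewrite mulrDl mul1r /=.
  rewrite -[X in `|X|](subrK ((t - t0) *: z)) (le_trans (ler_normD _ _))//.
  rewrite addrC normrZ mulrC; apply: lerD => //.
  by move: h1; rewrite mul1r.
exists C; split; first exact: near2.
have C0 : 0 <= C by rewrite mulr_ge0// addr_ge0.
have Zx s : win s -> loc Z c (x s) = Z c (Gamma s t0).
  by move=> /xr[cs _]; rewrite /loc coordK.
have Zx1 : loc Z c (x s1) = z by exact: Zx.
move=> s ws; have [cs xsr] := xr s ws.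
have dcs : is_derive t0 1 (coord c \o Gamma s) (Z c (Gamma s t0)).
  apply/is_derive_epsP => eta eta0.
  pose K := 4 * e * (Q * C ^+ 2).
  have K0 : 0 <= K by rewrite !mulr_ge0// ?sqr_ge0// ltW.
  have n3 := D1 (eta / 4) (divr_gt0 eta0 (ltr0n _ 4)).
  have n4 : \forall t \near t0, `|t - t0| < eta / (2 * (K + 1)).
    apply/nbhs_ballP; exists (eta / (2 * (K + 1))) => /=.
      by rewrite divr_gt0// mulr_gt0// ltr_wpDl.
    by move=> t; rewrite -ball_normE/= distrC.
  near=> t.
  have H : forall s, win s -> dom c (Gamma s t) /\ `|coord c (Gamma s t) - x0| < r.
    by near: t; exact: near1.
  have H2 : forall s, win s ->
      dom c (Gamma s t) /\ `|coord c (Gamma s t) - x s| <= C * `|t - t0|.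
    by near: t; exact: near2.
  have H3 : `|coord c (Gamma s1 t) - x s1 - (t - t0) *: z| <= eta / 4 * `|t - t0|.
    by near: t; exact: n3.
  have H4 : `|t - t0| < eta / (2 * (K + 1)) by near: t; exact: n4.
  have G := @short_gronwall R m
    (fun s => coord c (Gamma s t) - x s - (t - t0) *: loc Z c (x s))
    (fun s => loc Y c (coord c (Gamma s t)) - loc Y c (x s)
               - (t - t0) *: 'd (loc Z c) (x s) (loc Y c (x s)))
    (s0 - e) (s0 + e) L (Q * (C * `|t - t0|) ^+ 2) L0.
  have {}G : `|coord c (Gamma s t) - x s - (t - t0) *: loc Z c (x s)| <=
      2 * `|coord c (Gamma s1 t) - x s1 - (t - t0) *: loc Z c (x s1)|
      + 2 * (s0 + e - (s0 - e)) * (Q * (C * `|t - t0|) ^+ 2).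
    apply: G; [by rewrite mulr_ge0// sqr_ge0 | exact: eL | | exact: winP..].
    move=> u /winE wu; have [cu ur] := H u wu; have [cu0 ur0] := xr u wu.
    split.
      apply: is_deriveB; first by apply: is_deriveB; exact: dcurve.
      apply: is_deriveZ; apply: is_derive_comp; last exact: dcurve.
      by apply: (smooth_Z c).1; exact: cod_coord.
    have [_ q] := taylor _ _ ur0 ur; have [_ lip] := H2 u wu.
    rewrite -bracket0; last exact: cod_coord.
    have [_ bd] := Ur _ ur0.
    set w := coord c (Gamma u t) - x u in q lip *.
    have {}bd := bd (w - (t - t0) *: loc Z c (x u)).
    have lin : 'd (loc Y c) (x u) (w - (t - t0) *: loc Z c (x u)) =
        'd (loc Y c) (x u) w - (t - t0) *: 'd (loc Y c) (x u) (loc Z c (x u)).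
      by rewrite linearB linearZ.
    rewrite lin in bd.
    rewrite -(subrKA ('d (loc Y c) (x u) w)) (le_trans (ler_normD _ _))// addrC.
    rewrite lerD//; apply: le_trans q _; rewrite ler_wpM2l//.
    by rewrite lerXn2r ?nnegrE ?mulr_ge0.
  rewrite -[X in `|X|]/(coord c (Gamma s t) - x s - (t - t0) *: Z c (Gamma s t0)).
  rewrite -(Zx s ws); apply: le_trans G _; rewrite Zx1.
  have H5 : K * `|t - t0| <= eta / 2.
    move: H4; rewrite ltr_pdivlMr ?mulr_gt0 ?ltr_wpDl//.
    have := normr_ge0 (t - t0); move: `|t - t0| => h h0 hK; lra.
  have H6 : 2 * (s0 + e - (s0 - e)) * (Q * (C * `|t - t0|) ^+ 2) =
      K * `|t - t0| * `|t - t0| by rewrite /K; ring.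
  have H7 : K * `|t - t0| * `|t - t0| <= eta / 2 * `|t - t0|.
    by rewrite ler_wpM2r.
  by rewrite H6; lra.
have conts : {for t0, continuous (Gamma s)}.
  have cc : {for t0, continuous (coord c \o Gamma s)}.
    by apply: differentiable_continuous; apply/derivable1_diffP; case: dcs.
  have cp := continuous_comp cc (continuous_param (cod_coord cs)).
  have eqn : \forall t \near t0, (param c \o (coord c \o Gamma s)) t = Gamma s t.
    by apply: filterS near1 => t /(_ s ws)[ct _]; exact: coordK.
  move: cp; rewrite /prop_for /continuous_at (nbhs_singleton eqn).
  by apply: cvg_trans; apply: near_eq_cvg; apply: filterS eqn.
split=> // c' cs'; rewrite (tensor_Z cs cs').
exact: is_derive_chart.
Unshelve. all: by end_near. Qed.


(** The windows glue by continuity induction along the segment from [0] to the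
    given time. *)
Lemma transported_all t0 : transported 0 t0 -> forall s, transported s t0.
Proof.
move=> T0 u; suff : transported (1 * u) t0 by rewrite mul1r.
apply: (@unit_interval_ind R (fun s => transported (s * u) t0)); last first.
- by rewrite ler01 lexx.
- move=> t /andP[t0' t1] H.
  have [c cs] := @manifold_cover _ _ M (Gamma (t * u) t0).
  have [e [e0 win]] := transported_window cs.
  have T : transported (t * u) t0 by apply: H; rewrite t0' lexx.
  have tw : `|t * u - t * u| <= e by rewrite subrr normr0 ltW.
  have [C [_ HT]] := win _ tw T.
  exists (e / (`|u| + 1)); split.
    by rewrite divr_gt0// ltr_wpDl.
  move=> s /andP[ts ste] s1; apply: HT.
  rewrite -mulrBl normrM gtr0_norm ?subr_gt0//.
  move: ste; rewrite -ltrBlDl ltr_pdivlMr ?ltr_wpDl//.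
  have st0 : 0 < s - t by rewrite subr_gt0.
  lra.
- move=> t /andP[t0' t1] H.
  have [c cs] := @manifold_cover _ _ M (Gamma (t * u) t0).
  have [e [e0 win]] := transported_window cs.
  pose s := Num.max 0 (t - e / (`|u| + 1)).
  have st : s < t by rewrite /s gt_max t0'/= ltrBlDr ltrDl divr_gt0// ltr_wpDl.
  have s0 : 0 <= s by rewrite /s le_max lexx.
  have T : transported (s * u) t0 by apply: H; rewrite s0.
  have sw : `|s * u - t * u| <= e.
    rewrite -mulrBl normrM distrC (gtr0_norm (x := t - s)) ?subr_gt0//.
    have : t - e / (`|u| + 1) <= s by rewrite /s le_max lexx orbT.
    rewrite lerBlDl -lerBlDr ler_pdivlMr ?ltr_wpDl//.
    have st0 : 0 < t - s by rewrite subr_gt0.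
    lra.
  have [C [_ HT]] := win _ sw T.
  by apply: HT; rewrite subrr normr0 ltW.
- by rewrite mul0r.
Qed.

(** The flow of [Y] transports integral curves of [Z] to integral curves of
    [Z], so that the two-parameter surface [Gamma] has partial derivatives [Y]
    and [Z], whence the derivative along the diagonal. *)
Lemma integral_curve_diagonal : integral_curve Z (Gamma 0) ->
  integral_curve (fun c p => Y c p + Z c p) (fun t => Gamma t t).
Proof.
move=> [cZ dZ].
have T s t : transported s t.
  by apply: transported_all; split; [exact: cZ | move=> c; exact: dZ].
have main c t0 : dom c (Gamma t0 t0) ->
    (\forall t \near t0, dom c (Gamma t t)) /\
    is_derive t0 1 (fun t => coord c (Gamma t t))
      (Y c (Gamma t0 t0) + Z c (Gamma t0 t0)).
  move=> c0; have [e [e0 win]] := transported_window c0.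
  have w0 : `|t0 - t0| <= e by rewrite subrr normr0 ltW.
  have [C [near1 _]] := win _ w0 (T _ _).
  have near0 d : 0 < d -> \forall t \near t0, `|t - t0| < d.
    move=> d0; apply/nbhs_ballP; exists d => // t.
    by rewrite -ball_normE/= distrC.
  split.
    apply: filterS2 near1 (near0 _ e0) => t H te.
    by have [] := H t (ltW te).
  have DZ := (is_derive_epsP _ _ _).1 ((T t0 t0).2 c c0).
  apply/is_derive_epsP => eta eta0.
  have cloc : {for coord c (Gamma t0 t0), continuous (loc Y c)}.
    by apply: (class_CW (class_CW (smooth_Y c))); exact: cod_coord.
  have eta4 : 0 < eta / 4 by rewrite divr_gt0.
  have eta2 : 0 < eta / 2 by rewrite divr_gt0.
  set y0 := coord c (Gamma t0 t0).
  have /near_normP[d [d0 Hd]] : \forall y \near y0,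
      `|loc Y c y - loc Y c y0| < eta / 2.
    by apply: near_norm_lt cloc _; rewrite subrr normr0.
  pose x s := coord c (Gamma s t0).
  have cx : \forall s \near t0, `|x s - y0| < d / 2.
    have cx : {for t0, continuous x}.
      exact: (continuous_comp ((curve_Y t0).1 t0) (continuous_coord c0)).
    by apply: near_norm_lt cx _; rewrite subrr normr0 divr_gt0.
  have [d1 [d10 Hd1]] : exists d1 : R, 0 < d1 /\
      forall s, `|s - t0| < d1 -> `|x s - y0| < d / 2.
    move/nbhs_ballP : cx => [d1 /= d10 H]; exists d1; split=> // s sd.
    by apply: H; rewrite -ball_normE/= distrC.
  have Cn : 0 < d / (2 * (`|C| + 1)).
    by rewrite divr_gt0// mulr_gt0// ltr_wpDl.
  near=> t.
  have H1 : forall s, `|s - t0| <= e -> dom c (Gamma s t) /\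
      `|coord c (Gamma s t) - x s| <= C * `|t - t0|.
    by near: t; exact: near1.
  have H2 : `|coord c (Gamma t0 t) - y0 - (t - t0) *: Z c (Gamma t0 t0)|
      <= eta / 2 * `|t - t0|.
    by near: t; exact: DZ.
  have te : `|t - t0| < e by near: t; exact: near0.
  have td1 : `|t - t0| < d1 by near: t; exact: near0.
  have tC : `|t - t0| < d / (2 * (`|C| + 1)) by near: t; exact: near0.
  have CC : C * `|t - t0| < d / 2.
    have : C * `|t - t0| <= `|C| * `|t - t0| by rewrite ler_wpM2r// ler_norm.
    move: tC; rewrite ltr_pdivlMr ?mulr_gt0 ?ltr_wpDl//.
    have := normr_ge0 (t - t0); lra.
  (* The increment along the diagonal is split into a move in the second
     variable, governed by Z, and a move in the first one, where the curve w
     has speed at most eta / 2. *)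
  pose w s := coord c (Gamma s t) - s *: loc Y c y0.
  have dw s : `|s - t0| <= `|t - t0| -> is_derive s 1 w
      (loc Y c (coord c (Gamma s t)) - loc Y c y0) /\
      `|loc Y c (coord c (Gamma s t)) - loc Y c y0| <= eta / 2.
    move=> st; have [cs le1] := H1 s (le_trans st (ltW te)); split.
      apply: is_deriveB.
        by rewrite /loc coordK//; exact: (curve_Y t).2.
      apply/is_derive_epsP => e1 e10; near=> s'.
      by rewrite -scalerBl subrr normr0 mulr_ge0// ltW.
    apply/ltW/Hd; rewrite -(subrKA (x s)) (le_lt_trans (ler_normD _ _))//.
    have := Hd1 s (le_lt_trans st td1); lra.
  have MV : `|w t - w t0| <= eta / 2 * `|t - t0|.
    have eta20 := ltW eta2.
    have [t0t|tt0] := leP t0 t.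
      rewrite [X in _ * X]ger0_norm ?subr_ge0//.
      apply: (mean_value_ineq t0t eta20) => s /andP[s1 s2]; apply: dw.
      by rewrite !ger0_norm ?subr_ge0// lerD2r.
    rewrite distrC [X in _ * X]distrC [X in _ * X]gtr0_norm ?subr_gt0//.
    apply: (mean_value_ineq (ltW tt0) eta20) => s /andP[s1 s2]; apply: dw.
    by rewrite !(distrC _ t0) !ger0_norm ?subr_ge0// ?lerD2l ?lerN2// ltW.
  have -> : coord c (Gamma t t) - coord c (Gamma t0 t0) -
      (t - t0) *: (Y c (Gamma t0 t0) + Z c (Gamma t0 t0)) =
      (w t - w t0) +
      (coord c (Gamma t0 t) - y0 - (t - t0) *: Z c (Gamma t0 t0)).
    rewrite /w /loc /y0 coordK// -/y0.
    by apply/rowP => i; rewrite !mxE; ring.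
  apply: le_trans (ler_normD _ _) _; lra.
split.
- move=> t0; have [c c0] := @manifold_cover _ _ M (Gamma t0 t0).
  have [nd D] := main c t0 c0.
  have cc : {for t0, continuous (fun t => coord c (Gamma t t))}.
    by apply: differentiable_continuous; apply/derivable1_diffP; case: D.
  have cp := continuous_comp cc (continuous_param (cod_coord c0)).
  have eqn : \forall t \near t0,
      (param c \o (fun t => coord c (Gamma t t))) t = Gamma t t.
    by apply: filterS nd => t ct; exact: coordK.
  move: cp; rewrite /prop_for /continuous_at (nbhs_singleton eqn).
  by apply: cvg_trans; apply: near_eq_cvg; apply: filterS eqn.
- by move=> c t0 c0; have [_] := main c t0 c0.
Unshelve. all: by end_near. Qed.

End CommutingFlows.

(** * Symmetry of second derivatives *)

Section SecondDerivatives.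
Context {R : realType} {m : nat}.
Implicit Types (U : set 'rV[R]_m).

(** The mean value theorem in the direction [v] reduces the second difference
    to an increment of the directional derivative [fun y => 'd g y v], whose
    differentiability at [x] gives the limit. *)
Lemma second_difference U (g : 'rV[R]_m -> R) (x v w : 'rV[R]_m) :
  open U -> U x -> (forall y, U y -> differentiable g y) ->
  differentiable (fun y => 'd g y v) x ->
  forall e : R, 0 < e -> exists d : R, 0 < d /\ forall h, 0 < h < d ->
    `|g (x + h *: v + h *: w) - g (x + h *: v) - g (x + h *: w) + g x
      - h ^+ 2 * 'd (fun y => 'd g y v) x w| <= e * h ^+ 2.
Proof.
move=> oU Ux dg dG e e0; pose G y := 'd g y v; pose N := `|v| + `|w|.
have N0 : 0 <= N by rewrite addr_ge0.
have e10 : 0 < e / (2 * (N + 1)) by rewrite divr_gt0// mulr_gt0// ltr_wpDl.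
have nU : \forall y \near x, U y by apply: open_nbhs_nbhs.
have [r [r0 Hr]] := (near_normP _ _).1
  (@filterI _ _ (nbhs_filter x) _ _ nU (diff_eps dG e10)).
exists (r / (N + 1)); split; first by rewrite divr_gt0// ltr_wpDl.
move=> h /andP[h0]; rewrite ltr_pdivlMr ?ltr_wpDl// => hN.
have hNr : h * N < r by rewrite mulrDr mulr1 in hN; lra.
have small a b : 0 <= a <= h -> 0 <= b <= h -> `|a *: v + b *: w| <= h * N.
  move=> /andP[a0 ah] /andP[b0 bh].
  rewrite (le_trans (ler_normD _ _))// !normrZ !ger0_norm// mulrDr.
  by rewrite lerD// ler_wpM2r.
have hh : 0 <= h <= h by rewrite lexx ltW.
have h00 : 0 <= (0 : R) <= h by rewrite lexx ltW.
pose phi s := g (x + h *: w + s *: v) - g (x + s *: v).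
have inU s b : 0 <= s <= h -> 0 <= b <= h -> U (x + b *: w + s *: v) /\
    `|G (x + b *: w + s *: v) - G x - 'd G x (s *: v + b *: w)|
      <= e / (2 * (N + 1)) * (h * N).
  move=> sh bh; have E : x + b *: w + s *: v - x = s *: v + b *: w.
    by apply/rowP => i; rewrite !mxE; ring.
  have /Hr : `|x + b *: w + s *: v - x| < r.
    by rewrite E (le_lt_trans (small s b sh bh)).
  rewrite /= E => -[? le1]; split=> //; apply: le_trans le1 _.
  by rewrite ler_wpM2l ?small// ltW.
have dphi s : 0 <= s <= h -> is_derive s 1 phi
    (G (x + h *: w + s *: v) - G (x + s *: v)).
  move=> sh; apply: is_deriveB; apply: is_derive_line; apply: dg.
    by have [] := inU s h sh hh.
  by have [] := inU s 0 sh h00; rewrite scale0r addr0.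
have [|s|s] := @MVT_segment R phi
  (fun s => G (x + h *: w + s *: v) - G (x + s *: v)) 0 h (ltW h0).
- by move=> s; rewrite in_itv/= => /andP[/ltW ? /ltW ?]; apply: dphi; lra.
- apply: derivable_within_continuous => {}s; rewrite in_itv/= => /dphi D.
  by case: D.
rewrite in_itv/= subr0 /phi !scale0r !addr0 => sh E.
have [_ b1] := inU s h sh hh; have [_ b2] := inU s 0 sh h00.
rewrite scale0r addr0 in b2.
have lin : 'd G x (s *: v + h *: w) = 'd G x (s *: v + 0) + h * 'd G x w.
  by rewrite addr0 linearD; congr (_ + _); rewrite linearZ.
rewrite -/G.
have -> : g (x + h *: v + h *: w) - g (x + h *: v) - g (x + h *: w) + g x
    - h ^+ 2 * 'd G x w =
    h * ((G (x + h *: w + s *: v) - G x - 'd G x (s *: v + h *: w))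
       - (G (x + s *: v) - G x - 'd G x (s *: v + 0))).
  have -> : x + h *: v + h *: w = x + h *: w + h *: v by rewrite addrAC.
  rewrite lin; move: E.
  move: (g (x + h *: w + h *: v)) (g (x + h *: v)) (g (x + h *: w)) (g x).
  move=> g1 g2 g3 g4.
  move: (G (x + h *: w + s *: v)) (G (x + s *: v)) (G x) => G1 G2 G3.
  move: ('d G x w) ('d G x (s *: v + 0)) => d1 d2 E.
  have -> : g1 - g2 - g3 + g4 = (G1 - G2) * h by rewrite -E; ring.
  ring.
rewrite normrM gtr0_norm// expr2 mulrCA ler_wpM2l//; first exact: ltW.
apply: le_trans (ler_normB _ _) _; apply: le_trans (lerD b1 b2) _.
have -> : e / (2 * (N + 1)) * (h * N) + e / (2 * (N + 1)) * (h * N)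
    = e * h * (N / (N + 1)).
  by field; rewrite gt_eqF// ltr_wpDl.
have q1 : N / (N + 1) <= 1 by rewrite ler_pdivrMr ?ltr_wpDl// mul1r lerDl.
by apply: ler_piMr => //; apply: mulr_ge0; apply: ltW.
Qed.

Lemma second_quotient_unique (D : R -> R) (P Q : R) :
  (forall e : R, 0 < e -> exists d : R, 0 < d /\ forall h, 0 < h < d ->
     `|D h - h ^+ 2 * P| <= e * h ^+ 2) ->
  (forall e : R, 0 < e -> exists d : R, 0 < d /\ forall h, 0 < h < d ->
     `|D h - h ^+ 2 * Q| <= e * h ^+ 2) -> P = Q.
Proof.
move=> HP HQ; apply/eqP; rewrite -subr_eq0 -normr_le0.
apply/ler_addgt0Pr => e e0; rewrite add0r.
have e2 : 0 < e / 2 by rewrite divr_gt0.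
have [d1 [d10 H1]] := HP _ e2.
have [d2 [d20 H2]] := HQ _ e2.
pose h := Num.min d1 d2 / 2.
have hd : 0 < Num.min d1 d2 by rewrite lt_min d10.
have hh : 0 < h by rewrite divr_gt0.
have hlt : h < Num.min d1 d2 by rewrite /h ltr_pdivrMr// ltr_pMr// ltr1n.
have := H1 h; rewrite hh (lt_le_trans hlt) ?ge_min ?lexx// => /(_ isT) K1.
have := H2 h; rewrite hh (lt_le_trans hlt) ?ge_min ?lexx ?orbT// => /(_ isT) K2.
have h2 : 0 < h ^+ 2 by rewrite exprn_gt0.
rewrite -(ler_pM2r h2) -[X in `|_| * X]gtr0_norm// -normrM mulrBl.
have -> : P * h ^+ 2 - Q * h ^+ 2 =
    (D h - h ^+ 2 * Q) - (D h - h ^+ 2 * P) by ring.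
apply: le_trans (ler_normB _ _) _; lra.
Qed.

(** Symmetry of second derivatives: both orders of differentiation are the
    limit of the same second difference quotient. *)
Lemma diff2C U (g : 'rV[R]_m -> R) (x v w : 'rV[R]_m) :
  open U -> U x -> class_C 2 U g ->
  'd (fun y => 'd g y v) x w = 'd (fun y => 'd g y w) x v.
Proof.
move=> oU Ux [dg Cg].
apply: (second_quotient_unique (D := fun h =>
  g (x + h *: v + h *: w) - g (x + h *: v) - g (x + h *: w) + g x)) => e e0.
  exact: (second_difference w oU Ux dg ((Cg v).1 x Ux) e0).
have [d [d0 H]] := second_difference v oU Ux dg ((Cg w).1 x Ux) e0.
exists d; split=> // h /H; rewrite (addrAC x (h *: w)).
by rewrite [g _ - g (x + h *: w) - _]addrAC.
Qed.

End SecondDerivatives.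

(** * Hamiltonian vector fields in charts *)

Section Bilin.
Context {R : realType} {n : nat}.
Implicit Types (A : 'M[R]_n) (u v w : 'rV[R]_n).

Lemma bilinDl A u v w : bilin A (u + v) w = bilin A u w + bilin A v w.
Proof. by rewrite /bilin !mulmxDl mxE. Qed.

Lemma bilinNl A u w : bilin A (- u) w = - bilin A u w.
Proof. by rewrite /bilin !mulNmx mxE. Qed.

Lemma bilinZl A (k : R) u w : bilin A (k *: u) w = k * bilin A u w.
Proof. by rewrite /bilin -!scalemxAl mxE. Qed.

Lemma bilinDr A u v w : bilin A w (u + v) = bilin A w u + bilin A w v.
Proof. by rewrite /bilin linearD mulmxDr mxE. Qed.

Lemma bilin0l A u : bilin A 0 u = 0.
Proof. by rewrite /bilin !mul0mx mxE. Qed.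

Lemma bilin0r A u : bilin A u 0 = 0.
Proof. by rewrite /bilin linear0 mulmx0 mxE. Qed.

Lemma bilin_delta A i j : bilin A (delta_mx 0 i) (delta_mx 0 j) = A i j.
Proof.
by rewrite /bilin -rowE mxE (bigD1 j)//= big1 => [|l lj];
   rewrite !mxE !eqxx ?mulr1 ?addr0// (negPf lj) mulr0.
Qed.

Lemma bilin_antisym A : (forall u, bilin A u u = 0) ->
  forall u v, bilin A u v = - bilin A v u.
Proof.
move=> A0 u v; have := A0 (u + v); rewrite bilinDl !bilinDr !A0 add0r addr0.
by move/eqP; rewrite addr_eq0 => /eqP.
Qed.

End Bilin.

Section ProductRule.
Context {R : realType} {V : normedModType R}.

Lemma is_diff_sumr (n : nat) (h : 'I_n -> V -> R) (x : V) :
  (forall i, differentiable (h i) x) ->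
  is_diff x (fun y => \sum_i h i y) (fun w => \sum_i 'd (h i) x w).
Proof.
move=> dh; have E : (fun y => \sum_i h i y) = \sum_i h i.
  by apply/funext => y; rewrite fct_sumE.
have dS : differentiable (fun y => \sum_i h i y) x.
  by rewrite E; exact: differentiable_sum.
apply: DiffDef => //; apply/funext => w; rewrite -deriveE// E derive_sum.
  by apply: eq_bigr => i _; rewrite deriveE.
by move=> i; exact: diff_derivable.
Qed.

Lemma diff_mulmx (p q r : nat) (A : V -> 'M[R]_(p, q)) (B : V -> 'M[R]_(q, r))
    (x : V) : differentiable A x -> differentiable B x ->
  differentiable (fun y => A y *m B y) x /\
  forall w, 'd (fun y => A y *m B y) x w = 'd A x w *m B x + A x *m 'd B x w.
Proof.
move=> dA dB.
have dAe i l := differentiable_entry i l dA.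
have dBe l j := differentiable_entry l j dB.
have dM i j l : is_diff x (fun y => A y i l * B y l j)
    (fun w => A x i l * 'd B x w l j + B x l j * 'd A x w i l).
  exact: (is_diffM (dAe i l) (dBe l j)).
have dS i j := is_diff_sumr (fun l => @ex_diff _ _ _ _ _ _ _ (dM i j l)).
have E i j : (fun y => (A y *m B y) i j) = (fun y => \sum_l A y i l * B y l j).
  by apply/funext => y; rewrite mxE.
have [|dAB valAB] := @is_diff_mx _ _ _ _ (fun y => A y *m B y) x.
  by move=> i j; rewrite E; case: (dS i j).
split=> // w; rewrite valAB; apply/matrixP => i j.
rewrite mxE E (diff_valE w (dS i j)).
rewrite !mxE -big_split/=; apply: eq_bigr => l _.
by rewrite (diff_valE w (dM i j l)) addrC (mulrC (B x l j)).
Qed.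

Lemma diff_trmx (p q : nat) (A : V -> 'M[R]_(p, q)) (x : V) :
  differentiable A x ->
  differentiable (fun y => (A y)^T) x /\
  forall w, 'd (fun y => (A y)^T) x w = ('d A x w)^T.
Proof.
move=> dA; have dAe i j := differentiable_entry i j dA.
have E i j : (fun y => (A y)^T i j) = (fun y => A y j i).
  by apply/funext => y; rewrite mxE.
have [|dT valT] := @is_diff_mx _ _ _ _ (fun y => (A y)^T) x.
  by move=> i j; rewrite E; case: (dAe j i).
split=> // w; rewrite valT; apply/matrixP => i j.
by rewrite !mxE E (diff_valE w (dAe j i)).
Qed.

Lemma diff_bilin_form (n : nat) (A : V -> 'M[R]_n) (a b : V -> 'rV[R]_n) (x : V) :
  differentiable A x -> differentiable a x -> differentiable b x ->
  forall w, 'd (fun y => bilin (A y) (a y) (b y)) x w =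
    bilin ('d A x w) (a x) (b x) +
    bilin (A x) ('d a x w) (b x) + bilin (A x) (a x) ('d b x w).
Proof.
move=> dA da db w.
have [daA EaA] := diff_mulmx da dA.
have [dbT EbT] := diff_trmx db.
have [dall Eall] := diff_mulmx daA dbT.
have Em := etrans (Eall w)
  (congr2 (fun P Q => P *m (b x)^T + a x *m A x *m Q) (EaA w) (EbT w)).
apply: etrans (diff_valE w (differentiable_entry 0 0 dall)) _.
apply: etrans (congr1 (fun P : 'M[R]_1 => P 0 0) Em) _.
by rewrite mulmxDl [LHS]mxE [X in X + _ = _]mxE [X in X + _ = _]addrC.
Qed.

Lemma diff_bilin_cstr (n : nat) (A : V -> 'M[R]_n) (a : V -> 'rV[R]_n) b (x : V) :
  differentiable A x -> differentiable a x ->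
  forall w, 'd (fun y => bilin (A y) (a y) b) x w =
    bilin ('d A x w) (a x) b + bilin (A x) ('d a x w) b.
Proof.
move=> dA da w; apply: etrans (diff_bilin_form dA da (differentiable_cst b x) w) _.
have b0 : 'd (fun=> b) x w = 0 := congr1 (@^~ w) (diff_cst b x).
apply: etrans (congr1 (fun u => _ + bilin (A x) (a x) u) b0) _.
by rewrite bilin0r addr0.
Qed.

Lemma diff_bilin_cst (n : nat) (A : V -> 'M[R]_n) a b (x : V) :
  differentiable A x ->
  forall w, 'd (fun y => bilin (A y) a b) x w = bilin ('d A x w) a b.
Proof.
move=> dA w; apply: etrans (diff_bilin_cstr b dA (differentiable_cst a x) w) _.
have a0 : 'd (fun=> a) x w = 0 := congr1 (@^~ w) (diff_cst a x).
apply: etrans (congr1 (fun u => _ + bilin (A x) u b) a0) _.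
by rewrite bilin0l addr0.
Qed.

End ProductRule.

Section Hamiltonian.
Context {R : realType} {m : nat} {M : manifold R m} (omega : symplectic M).
Implicit Types (c : mindex M) (p : M) (g h : M -> R).

Let loc (X : vfield M) c (x : 'rV[R]_m) := X c (param c x).
Let Om c (x : 'rV[R]_m) : 'M[R]_m := smx omega c (param c x).

Lemma msmoothP (W : normedModType R) (g : M -> W) :
  msmooth g <-> forall c k, class_C k (cod c) (g \o param c).
Proof.
rewrite /msmooth /msmooth_on /smooth_on /cod.
by split=> H c k; have := H c k; rewrite setIT.
Qed.

Lemma mdiffE (W : normedModType R) (g : M -> W) c x v : cod c x ->
  mdiff g c (param c x) v = 'd (g \o param c) x v.
Proof. by move=> cx; rewrite /mdiff paramK. Qed.

Lemma smooth_Om c k : class_C k (cod c) (Om c).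
Proof.
apply: class_C_mx => [|i j]; first exact: open_cod.
apply: class_C_ext (@smx_smooth _ _ _ omega c (delta_mx 0 i) (delta_mx 0 j) k).
  exact: open_cod.
by move=> x _; exact: bilin_delta.
Qed.

Lemma ham_locE g c x : cod c x ->
  loc (hamiltonian_vfield omega g) c x =
  (\row_j 'd (g \o param c) x (delta_mx 0 j)) *m invmx (Om c x).
Proof.
move=> cx; apply/esym/sharp_uniq => [|v]; first exact: dom_param.
rewrite /sform /bilin mulmxKV ?sform_unitmx//; last exact: dom_param.
rewrite mdiffE// mxE (linear_row_sum ('d (g \o param c) x)).
apply: eq_bigr => j _.
by rewrite !mxE mulrC.
Qed.

Lemma smooth_ham g c k : msmooth g ->
  class_C k (cod c) (loc (hamiltonian_vfield omega g) c).
Proof.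
move=> /msmoothP sg; have oc : open (cod c) := @open_cod _ _ M c.
apply: (class_C_ext oc (fun x cx => esym (ham_locE g cx))).
apply: (class_C_mulmx oc).
  apply: (class_C_mx oc) => i j.
  apply: (class_C_ext oc _ ((sg c k.+1).2 (delta_mx 0 j))) => x _.
  by rewrite mxE.
apply: (class_C_invmx oc); last exact: smooth_Om.
by move=> x cx; apply: sform_unitmx; exact: dom_param.
Qed.

(** Elimination behind [bracket_ham]: the [s_i] are values of the symplectic
    form on [X], [Y] and their derivatives, the [t_i] those of its derivative. *)
Let bracket_algebra (s1 s2 s3 s4 s5 t1 t2 t3 t4 t6 : R) :
  t1 + s1 = t2 + s3 -> t3 + s2 = t4 + s4 -> t2 + t3 + t6 = 0 ->
  t2 + s3 + s5 = 0 -> t6 = - t1 -> s5 = - s4 -> t4 = - t2 -> s1 + - s2 = 0.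
Proof. lra. Qed.

(** The bracket of two Hamiltonian fields is the Hamiltonian field of the
    Poisson bracket of their Hamiltonians, here zero.  In a chart: differentiate
    [omega(X, v) = dg v], [omega(Y, v) = dh v] and [omega(X, Y) = 0]; by the
    symmetry of second derivatives and the closedness of [omega], the pairing
    of the bracket with every [v] vanishes. *)
Lemma bracket_ham g h c x : msmooth g -> msmooth h ->
  (forall p, dom c p -> sform omega c p (hamiltonian_vfield omega g c p)
                                  (hamiltonian_vfield omega h c p) = 0) ->
  cod c x ->
  let X := loc (hamiltonian_vfield omega g) c in
  let Y := loc (hamiltonian_vfield omega h) c in
  'd X x (Y x) = 'd Y x (X x).
Proof.
move=> sg sh gh0 cx X Y; have oc : open (cod c) := @open_cod _ _ M c.
pose gl := g \o param c; pose hl := h \o param c.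
have dX : differentiable X x by exact: (smooth_ham c 1 sg).1.
have dY : differentiable Y x by exact: (smooth_ham c 1 sh).1.
have dO : differentiable (Om c) x by exact: (smooth_Om c 1).1.
pose T u v w := bilin ('d (Om c) x u) v w.
pose S v w := bilin (Om c x) v w.
have diff_eq (F G : 'rV[R]_m -> R) w : (forall y, cod c y -> F y = G y) ->
    differentiable F x -> 'd G x w = 'd F x w.
  move=> FG dF; have D : is_diff x G ('d F x).
    apply: near_eq_is_diff => //.
    by apply: (@filterS _ _ (nbhs_filter x) _ _ _ (near_cod cx)) => y /FG.
  exact: diff_valE D.
have diff0 (F : 'rV[R]_m -> R) w : (forall y, cod c y -> F y = 0) ->
    'd F x w = 0.
  move=> F0; have d0 : 'd (fun=> 0 : R) x w = 0 := congr1 (@^~ w) (diff_cst 0 x).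
  apply: etrans d0; apply: diff_eq (fun y cy => esym (F0 y cy)) _.
  exact: differentiable_cst.
have XP v y : cod c y -> bilin (Om c y) (X y) v = 'd gl y v.
  move=> cy; rewrite -mdiffE//.
  exact: (hamiltonian_vfieldP omega g (dom_param cy) v).
have YP v y : cod c y -> bilin (Om c y) (Y y) v = 'd hl y v.
  move=> cy; rewrite -mdiffE//.
  exact: (hamiltonian_vfieldP omega h (dom_param cy) v).
have E1 w v : T w (X x) v + S ('d X x w) v = 'd (fun y => 'd gl y v) x w.
  have dgl : differentiable (fun y => 'd gl y v) x.
    by exact: (((msmoothP g).1 sg c 2).2 v).1.
  apply: etrans (esym (diff_bilin_cstr v dO dX w)) _.
  exact: diff_eq (fun y cy => esym (XP v y cy)) dgl.
have E2 w v : T w (Y x) v + S ('d Y x w) v = 'd (fun y => 'd hl y v) x w.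
  have dhl : differentiable (fun y => 'd hl y v) x.
    by exact: (((msmoothP h).1 sh c 2).2 v).1.
  apply: etrans (esym (diff_bilin_cstr v dO dY w)) _.
  exact: diff_eq (fun y cy => esym (YP v y cy)) dhl.
have E3 w : T w (X x) (Y x) + S ('d X x w) (Y x) + S (X x) ('d Y x w) = 0.
  apply: etrans (esym (diff_bilin_form dO dX dY w)) _.
  by apply: diff0 => y cy; exact: (gh0 _ (dom_param cy)).
have closed u v w : T u v w + T v w u + T w u v = 0.
  have dT a b w' : 'd (fun y => bilin (Om c y) a b) x w' = T w' a b.
    exact: diff_bilin_cst.
  by rewrite -!dT; exact: (@smx_closed _ _ _ omega c x u v w cx).
have Santi u v : S u v = - S v u.
  by apply: bilin_antisym => w; apply: smx_alternating; exact: dom_param.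
have Tanti w u v : T w u v = - T w v u.
  apply: bilin_antisym => z.
  apply: etrans (esym (diff_bilin_cst z z dO w)) _.
  apply: diff0 => y cy; apply: smx_alternating; exact: dom_param.
apply/eqP; rewrite -subr_eq0; apply/eqP.
apply: (@smx_nondegenerate _ _ _ omega _ _ _ (dom_param cx)) => v.
have G := etrans (E1 (Y x) v) (etrans
  (diff2C v (Y x) oc cx ((msmoothP g).1 sg c 2)) (esym (E1 v (Y x)))).
have H := etrans (E2 (X x) v) (etrans
  (diff2C v (X x) oc cx ((msmoothP h).1 sh c 2)) (esym (E2 v (X x)))).
have key : S ('d X x (Y x)) v + - S ('d Y x (X x)) v = 0.
  exact: (bracket_algebra G H (closed v (X x) (Y x)) (E3 v)
    (Tanti (Y x) v (X x)) (Santi (X x) ('d Y x v)) (Tanti v (Y x) (X x))).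
apply: etrans key; apply: etrans (bilinDl _ _ _ _) _.
by congr (_ + _); exact: bilinNl.
Qed.

(** The field is defined chart by chart, but both the symplectic form and
    the differential of [h] are tensors; nondegeneracy does the rest. *)
Lemma ham_tensor h c c' p : msmooth h -> dom c p -> dom c' p ->
  hamiltonian_vfield omega h c' p =
  'd (transition (mchart c) (mchart c')) (coord c p)
    (hamiltonian_vfield omega h c p).
Proof.
move=> sh cp cp'.
pose tau := transition (mchart c) (mchart c').
pose tau' := transition (mchart c') (mchart c).
have dtau : differentiable tau (coord c p).
  by have [+ _] := @manifold_compat _ _ M c c' 1; apply; exists p.
have dtau' : differentiable tau' (coord c' p).
  by have [+ _] := @manifold_compat _ _ M c' c 1; apply; exists p.
have tauE : tau (coord c p) = coord c' p.
  by rewrite /tau/transition/= [X in chart_fun _ X]coordK.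
have tau'E : tau' (coord c' p) = coord c p.
  by rewrite /tau'/transition/= [X in chart_fun _ X]coordK.
have inv v : 'd tau (coord c p) ('d tau' (coord c' p) v) = v.
  have near_id : \forall y \near coord c' p, id y = (tau \o tau') y.
    have n1 := near_cod (cod_coord cp').
    have n2 : \forall y \near coord c' p, dom c (param c' y).
      apply: (continuous_param (cod_coord cp')).
      by rewrite coordK//; exact: near_dom.
    apply: (@filterS2 _ _ (nbhs_filter _) _ _ _ _ n1 n2) => y cy cy'.
    rewrite /tau /tau' /transition /=.
    by rewrite [X in chart_fun _ X](coordK cy') [RHS](paramK cy).
  have Did : is_diff (coord c' p) (id : 'rV[R]_m -> 'rV[R]_m) id.
    exact: is_diff_id.
  have D := near_eq_is_diff near_id (@ex_diff _ _ _ _ _ _ _ Did).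
  have dtau2 : differentiable tau (tau' (coord c' p)) by rewrite tau'E.
  have E1 := diff_valE v D; have E2 := diff_valE v Did.
  have := congr1 (@^~ v) (diff_comp dtau' dtau2); rewrite tau'E => E3.
  exact: etrans (esym E3) (etrans E1 E2).
apply/esym/sharp_uniq => // v'.
suff {v'} dual v : sform omega c' p
    ('d tau (coord c p) (hamiltonian_vfield omega h c p)) ('d tau (coord c p) v) =
    mdiff h c' p ('d tau (coord c p) v).
  by rewrite -(inv v'); exact: dual.
apply: etrans (esym (smx_tensor omega _ v cp cp')) _.
apply: etrans (hamiltonian_vfieldP omega h cp v) _.
have near_h : \forall y \near coord c p,
    ((h \o param c') \o tau) y = (h \o param c) y.
  have n1 := near_cod (cod_coord cp).
  have n2 : \forall y \near coord c p, dom c' (param c y).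
    apply: (continuous_param (cod_coord cp)).
    by rewrite coordK//; exact: near_dom.
  apply: (@filterS2 _ _ (nbhs_filter _) _ _ _ _ n1 n2) => y cy cy'.
  by rewrite /tau /transition /= [X in h X](coordK cy').
have dh' : differentiable (h \o param c') (tau (coord c p)).
  by rewrite tauE; exact: (((msmoothP h).1 sh c' 1).1 _ (cod_coord cp')).
have E1 := diff_valE v (near_eq_is_diff near_h (differentiable_comp dtau dh')).
have := congr1 (@^~ v) (diff_comp dtau dh'); rewrite tauE => E2.
exact: etrans E1 E2.
Qed.

End Hamiltonian.

(** * Completeness of sums of commuting Hamiltonian fields *)

Section CompleteSums.
Context {R : realType} {m : nat} {M : manifold R m} (omega : symplectic M).
Implicit Types (c : mindex M) (p : M) (g h : M -> R) (F : set M).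

Lemma msmooth_differentiable (W : normedModType R) (g : M -> W) c p :
  msmooth g -> dom c p -> differentiable (g \o param c) (coord c p).
Proof. by move=> /msmoothP sg cp; exact: (sg c 1).1 _ (cod_coord cp). Qed.

Lemma msmoothD g h : msmooth g -> msmooth h -> msmooth (fun p => g p + h p).
Proof.
move=> /msmoothP sg /msmoothP sh; apply/msmoothP => c k.
exact: (class_CD (open_cod (c := c)) (sg c k) (sh c k)).
Qed.

Lemma msmooth_cst (a : R) : msmooth (fun _ : M => a).
Proof. by apply/msmoothP => c k; exact: class_C_cst. Qed.

Lemma msmoothZ (a : R) g : msmooth g -> msmooth (fun p => a * g p).
Proof.
move=> /msmoothP sg; apply/msmoothP => c k.
exact: (class_CM (open_cod (c := c)) (class_C_cst _ _ a) (sg c k)).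
Qed.

Lemma mdiffD g h c p v : msmooth g -> msmooth h -> dom c p ->
  mdiff (fun q => g q + h q) c p v = mdiff g c p v + mdiff h c p v.
Proof.
move=> sg sh cp.
exact: (diff_valE v (is_diffD (differentiableP (msmooth_differentiable sg cp))
                              (differentiableP (msmooth_differentiable sh cp)))).
Qed.

Lemma mdiffZ (a : R) g c p v : msmooth g -> dom c p ->
  mdiff (fun q => a * g q) c p v = a * mdiff g c p v.
Proof.
move=> sg cp.
exact: (diff_valE v (is_diffZ a (differentiableP (msmooth_differentiable sg cp)))).
Qed.

Lemma mdiff_cst (a : R) c p v : mdiff (fun _ : M => a) c p v = 0.
Proof. exact: (congr1 (@^~ v) (diff_cst a (coord c p))). Qed.

Local Notation ham := (hamiltonian_vfield omega).

Lemma hamD g h c p : msmooth g -> msmooth h -> dom c p ->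
  ham (fun q => g q + h q) c p = ham g c p + ham h c p.
Proof.
move=> sg sh cp; apply/esym/sharp_uniq => // v.
rewrite mdiffD// /sform bilinDl -(hamiltonian_vfieldP omega g cp).
by rewrite -(hamiltonian_vfieldP omega h cp).
Qed.

Lemma hamZ (a : R) g c p : msmooth g -> dom c p ->
  ham (fun q => a * g q) c p = a *: ham g c p.
Proof.
move=> sg cp; apply/esym/sharp_uniq => // v.
by rewrite mdiffZ// /sform bilinZl -(hamiltonian_vfieldP omega g cp).
Qed.

Lemma ham_cst (a : R) c p : dom c p -> ham (fun=> a) c p = 0.
Proof.
by move=> cp; apply/esym/sharp_uniq => // v; rewrite mdiff_cst /sform bilin0l.
Qed.

Lemma integral_curve_ext (X X' : vfield M) (gamma : R -> M) :
  (forall c t, dom c (gamma t) -> X c (gamma t) = X' c (gamma t)) ->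
  integral_curve X gamma -> integral_curve X' gamma.
Proof. by move=> XX' [cg dg]; split=> // c t ct; rewrite -XX'//; exact: dg. Qed.

Lemma complete_ham_cst F (a : R) : complete_on F (ham (fun=> a)).
Proof.
move=> p Fp; exists (fun=> p); split=> //; split; first exact: cst_continuous.
by move=> c t cp; rewrite ham_cst//; exact: is_derive_cst.
Qed.

Lemma complete_hamZ F (a : R) g : msmooth g ->
  complete_on F (ham g) -> complete_on F (ham (fun q => a * g q)).
Proof.
move=> sg cF p /cF[gamma [g0 [cg dg] Fg]].
exists (fun t => gamma (0 + t * a)); split=> //; first by rewrite mul0r addr0.
split.
  move=> t; have ct : {for t, continuous (fun h : R => 0 + h * a)}.
    apply: continuousD; first exact: cst_continuous.
    by apply: continuousM => //; exact: cst_continuous.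
  exact: (continuous_comp ct (cg (0 + t * a))).
move=> c t ct; rewrite hamZ//.
by apply: (@is_derive_affine R _ (coord c \o gamma) 0 a t); exact: dg.
Qed.

(** The two flows commute, so that running them one after the other for the
    same time gives the flow of the sum. *)
Lemma complete_hamD F g h : msmooth g -> msmooth h ->
  (forall c p, dom c p -> sform omega c p (ham g c p) (ham h c p) = 0) ->
  complete_on F (ham g) -> complete_on F (ham h) ->
  complete_on F (ham (fun q => g q + h q)).
Proof.
move=> sg sh gh0 cFg cFh p /cFh[zeta [zeta0 izeta Fzeta]].
have /choice[f fP] := fun t => cFg _ (Fzeta t).
pose Gamma s t := f t s.
have G0 : Gamma 0 = zeta by apply/funext => t; have [] := fP t.
exists (fun t => Gamma t t); split.
- by rewrite [Gamma 0]G0.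
- apply: (@integral_curve_ext (fun c p => ham g c p + ham h c p)).
    by move=> c t ct; rewrite hamD.
  apply: integral_curve_diagonal.
  + by move=> c; exact: smooth_ham.
  + by move=> c; exact: smooth_ham.
  + by move=> c x cx; apply: bracket_ham => // q; exact: gh0.
  + by move=> c c' q; exact: ham_tensor.
  + by move=> t; have [] := fP t.
  + by rewrite G0.
- by move=> t; have [_ _] := fP t; exact.
Qed.

Lemma complete_ham_sum F (n : nat) (f : 'I_n -> M -> R) (a : 'I_n -> R)
    (r : seq 'I_n) :
  (forall i, msmooth (f i)) ->
  (forall c p i j, dom c p ->
     sform omega c p (ham (f i) c p) (ham (f j) c p) = 0) ->
  (forall i, complete_on F (ham (f i))) ->
  let g := fun q => \sum_(i <- r) a i * f i q in
  [/\ msmooth g, complete_on F (ham g) &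
    forall c p v, dom c p -> mdiff g c p v = \sum_(i <- r) a i * mdiff (f i) c p v].
Proof.
move=> sf f0 cF; elim: r => [|i r [sg cg dg]] /=.
  have -> : (fun q => \sum_(i <- [::]) a i * f i q) = fun=> 0.
    by apply/funext => q; rewrite big_nil.
  split; [exact: msmooth_cst | exact: complete_ham_cst |].
  by move=> c p v cp; rewrite mdiff_cst big_nil.
have -> : (fun q => \sum_(j <- i :: r) a j * f j q) =
    fun q => a i * f i q + \sum_(j <- r) a j * f j q.
  by apply/funext => q; rewrite big_cons.
have sfi := msmoothZ (a i) (sf i).
split; first exact: msmoothD.
- have czi := complete_hamZ (a i) (sf i) (cF i).
  have comm0 c p : dom c p -> sform omega c p (ham (fun q => a i * f i q) c p)
      (ham (fun q => \sum_(j <- r) a j * f j q) c p) = 0; last first.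
    exact: (complete_hamD sfi sg comm0 czi cg).
  move=> cp.
  rewrite hamZ// /sform bilinZl.
  rewrite (bilin_antisym (fun u => smx_alternating omega _ cp)) mulrN.
  rewrite -[bilin _ _ _]/(sform omega c p _ _) hamiltonian_vfieldP// dg//.
  rewrite big1 ?mulr0 ?oppr0// => j _.
  by rewrite -(hamiltonian_vfieldP omega (f j) cp) f0// mulr0.
- by move=> c p v cp; rewrite mdiffD// mdiffZ// dg// big_cons.
Qed.

End CompleteSums.

(** * Submersions are open *)

Section OpenMap.
Context {R : realType} {m n : nat}.

(** Strict differentiability: [g] minus its linear part at [x0] has small
    differential near [x0], hence a small Lipschitz constant. *)
Lemma class_C1_strict (U : set 'rV[R]_m) (g : 'rV[R]_m -> 'rV[R]_n) x0 (e : R) :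
  open U -> U x0 -> class_C 1 U g -> 0 < e ->
  exists r : R, 0 < r /\ forall x, `|x - x0| < r -> U x /\
    forall y, `|y - x0| < r -> `|g y - g x - 'd g x0 (y - x)| <= e * `|y - x|.
Proof.
move=> oU Ux0 [dg cg] e0.
pose k := e / (m%:R + 1).
have k0 : 0 < k by rewrite divr_gt0// ltr_wpDl.
have nU : \forall x \near x0, U x by apply: open_nbhs_nbhs.
have nd : \forall x \near x0, forall j : 'I_m,
    `|'d g x (delta_mx 0 j) - 'd g x0 (delta_mx 0 j)| <= k.
  apply: (@filter_forall _ _ _ _ (nbhs_filter x0)) => j.
  by have /(@cvgrPdistC_le _ _ _ (nbhs x0)) /(_ k k0) := cg (delta_mx 0 j) x0 Ux0.
have [r [r0 H]] := (near_normP _ _).1 (@filterI _ _ (nbhs_filter x0) _ _ nU nd).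
exists r; split=> // x xr; split; first by have [] := H x xr.
move=> y yr; pose L : 'rV[R]_m -> 'rV[R]_n := 'd g x0.
have dL z : is_diff z L L.
  have cL : continuous ('d g x0) by apply: diff_continuous; exact: dg.
  by apply: DiffDef; [exact: linear_differentiable | exact: diff_lin].
have dgL z : U z -> is_diff z (g - L) (('d g z : 'rV[R]_m -> 'rV[R]_n) - L).
  by move=> Uz; exact: (is_diffB (differentiableP (dg z Uz)) (dL z)).
have dgz z : `|z - x0| < r -> differentiable (g - L) z.
  by move=> /H[/dgL[]].
have bgz z : `|z - x0| < r -> forall v, `|'d (g - L) z v| <= e * `|v|.
  move=> zr v; have [Uz nz] := H z zr.
  apply: (@le_trans _ _ ((\sum_(j < m) k) * `|v|)).
    apply: linear_bound => j; have E := diff_valE (delta_mx 0 j) (dgL z Uz).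
    by apply: (le_trans _ (nz j)); rewrite le_eqVlt; apply/orP; left; apply/eqP;
       exact: (congr1 Num.norm E).
  rewrite ler_wpM2r// sumr_const card_ord -mulr_natr /k mulrAC.
  rewrite ler_pdivrMr ?ltr_wpDl//.
  by rewrite ler_wpM2l ?(ltW e0)// lerDl.
have := lipschitz_ball (ltW e0) dgz bgz xr yr.
have -> // : (g - L) y - (g - L) x = g y - g x - 'd g x0 (y - x).
rewrite [X in _ - X = _]/(g x - L x) [X in X - _ = _]/(g y - L y).
have -> : 'd g x0 (y - x) = L y - L x by exact: linearB.
by apply/rowP => i; rewrite !mxE; ring.
Qed.

(** On the image of a right inverse of the differential, the map is the
    identity plus a perturbation with Lipschitz constant 1/2.  A point of a
    small closed ball whose image is closest to [z] is interior, and moving it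
    against the defect would decrease a nonzero defect. *)
Lemma submersion_locally_onto (U : set 'rV[R]_m) (g : 'rV[R]_m -> 'rV[R]_n) x0 :
  open U -> U x0 -> class_C 1 U g -> (forall w, exists v, 'd g x0 v = w) ->
  \forall z \near g x0, exists x, U x /\ g x = z.
Proof.
move=> oU Ux0 Cg onto.
have /choice[v dv] := fun j : 'I_n => onto (delta_mx 0 j).
pose V : 'M[R]_(n, m) := \matrix_j v j.
have dV y : 'd g x0 (y *m V) = y.
  rewrite mulmx_sum_row linear_sum [RHS]row_sum_delta; apply: eq_bigr => j _.
  by rewrite linearZ rowK; congr (_ *: _); exact: dv.
pose N := \sum_(j < n) `|v j|.
have N0 : 0 <= N by apply: sumr_ge0.
have VN (y : 'rV[R]_n) : `|y *m V| <= N * `|y|.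
  rewrite mulmx_sum_row (le_trans (ler_norm_sum _ _ _))// mulr_suml.
  apply: ler_sum => j _; rewrite rowK normrZ mulrC ler_wpM2l//.
  exact: norm_entry_le.
have e0 : 0 < (2 * (N + 1))^-1 :> R by rewrite invr_gt0 mulr_gt0// ltr_wpDl.
have [r [r0 H]] := class_C1_strict oU Ux0 Cg e0.
pose psi (y : 'rV[R]_n) := g (x0 + y *m V).
pose rho := r / (2 * (N + 1)).
have rho0 : 0 < rho by rewrite divr_gt0// mulr_gt0// ltr_wpDl.
have inr (y : 'rV[R]_n) : `|y| <= rho -> `|x0 + y *m V - x0| < r.
  move=> yr; rewrite addrC addKr (le_lt_trans (VN y))//.
  have le1 : N * `|y| <= N * rho by rewrite ler_wpM2l.
  apply: le_lt_trans le1 _; rewrite /rho mulrA ltr_pdivrMr ?mulr_gt0 ?ltr_wpDl//.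
  by have := mulr_ge0 N0 (ltW r0); nra.
have contr y y' : `|y| <= rho -> `|y'| <= rho ->
    `|psi y' - psi y - (y' - y)| <= 2^-1 * `|y' - y|.
  move=> yr y'r; have [_ Hx] := H _ (inr y yr).
  have := Hx _ (inr y' y'r).
  have -> : x0 + y' *m V - (x0 + y *m V) = (y' - y) *m V.
    by rewrite mulmxBl opprD addrACA subrr add0r.
  rewrite dV => le1; apply: le_trans le1 _.
  apply: (@le_trans _ _ ((2 * (N + 1))^-1 * (N * `|y' - y|))).
    by rewrite ler_wpM2l ?VN// ltW.
  rewrite mulrA ler_wpM2r// mulrC ler_pdivrMr ?mulr_gt0 ?ltr_wpDl//.
  by rewrite mulrA mulVf// mul1r lerDl.
apply/near_normP; exists (rho / 4); split; first by rewrite divr_gt0.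
move=> z zr; pose A := [set y : 'rV[R]_n | `|y| <= rho].
have A0 : A 0 by rewrite /A/= normr0 ltW.
have psi0 : psi 0 = g x0 by rewrite /psi mul0mx addr0.
have cpsi : {within A, continuous (fun y => `|psi y - z|)}.
  apply: continuous_in_subspaceT => y; rewrite inE => yA.
  have [Uy _] := H _ (inr y yA).
  have cmul : {for y, continuous (fun y : 'rV[R]_n => x0 + y *m V)}.
    apply: continuousD; first exact: cst_continuous.
    have C0 : class_C 0 setT (fun y : 'rV[R]_n => y *m V).
      apply: class_C_mulmx; [exact: openT | | exact: class_C_cst].
      by move=> u _; exact: cvg_id.
    exact: C0.
  have cg : {for x0 + y *m V, continuous g} by exact: (class_CW Cg).
  have cp : {for y, continuous psi} := continuous_comp cmul cg.
  have cq : {for y, continuous (fun u => psi u - z)}.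
    by apply: continuousB; [exact: cp | exact: cst_continuous].
  exact: (continuous_comp cq (@norm_continuous _ _ (psi y - z))).
have cA : compact A.
  apply: bounded_closed_compact.
    exists rho; split; first exact: num_real.
    by move=> K rK x /= xr; apply: ltW; exact: le_lt_trans rK.
  have -> : A = closed_ball_ (@Num.norm R 'rV[R]_n) 0 rho.
    by apply/seteqP; split=> x /=; rewrite /A/closed_ball_/= sub0r normrN.
  exact: closed_closed_ball_.
have [y] := EVT_min_rV (ex_intro _ 0 A0) cA cpsi.
rewrite inE => yA ymin.
exists (x0 + y *m V); split; first by have [] := H _ (inr y yA).
apply/eqP; rewrite -subr_eq0 -/(psi y); apply: contraT => dy0.
pose d := psi y - z; have d0 : 0 < `|d| by rewrite normr_gt0.
have dlt : `|d| < rho / 4.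
  apply: le_lt_trans zr; rewrite [leRHS]distrC -psi0.
  by apply: (ymin 0); rewrite inE.
have ylt : `|y| < rho.
  have c1 := contr 0 y A0 yA; rewrite subr0 in c1.
  have c2 : `|y| <= `|psi y - psi 0| + `|psi y - psi 0 - y|.
    by rewrite -{1}(subKr (psi y - psi 0) y) ler_normB.
  have c3 : `|psi y - psi 0| <= `|d| + `|z - psi 0|.
    by rewrite -(subrKA z (psi y)) ler_normD.
  rewrite psi0 in c1 c2 c3; rewrite distrC in zr.
  rewrite [`|z - _|]distrC in c3; lra.
(* The largest step t <= 1 that keeps y - t d in the ball. *)
pose t := Num.min 1 ((rho - `|y|) / `|d|).
have t0 : 0 < t by rewrite lt_min ltr01 divr_gt0// subr_gt0.
have t1 : t <= 1 by rewrite ge_min lexx.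
have td : t * `|d| <= rho - `|y| by rewrite -ler_pdivlMr// ge_min lexx orbT.
pose y' := y - t *: d.
have y'A : A y'.
  rewrite /A/= (le_trans (ler_normB _ _))// normrZ gtr0_norm//; lra.
have := ymin y'; rewrite inE => /(_ y'A).
have := contr y y' yA y'A.
have -> : y' - y = - (t *: d) by rewrite /y' addrC addKr.
rewrite opprK normrN normrZ gtr0_norm// => c1 c2.
have : `|psi y' - z| <= (1 - t) * `|d| + 2^-1 * (t * `|d|).
  have -> : psi y' - z = (1 - t) *: d + (psi y' - psi y + t *: d).
    by rewrite /d; apply/rowP => i; rewrite !mxE; ring.
  rewrite (le_trans (ler_normD _ _))// lerD// normrZ ger0_norm ?subr_ge0//.
have td0 : 0 < t * `|d| by rewrite mulr_gt0.
move: c2; rewrite -/d => c2 c3; lra.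
Qed.

End OpenMap.

(** * The fibration of an integrable system *)

Section IntegrableFibration.
Context {R : realType} {n : nat} {M : manifold R (2 * n)%N}
  {omega : symplectic M} {H : M -> R} {f : 'I_n -> M -> R}.
Hypothesis Hf : completely_integrable omega H f.
Implicit Types (c : mindex M) (p : M).

Local Notation pi := (momentum_map f).
Local Notation ham := (hamiltonian_vfield omega).

Lemma msmooth_momentum : msmooth pi.
Proof.
apply/msmoothP => c k; apply: (class_C_mx (open_cod (c := c))) => i j.
apply: (class_C_ext (open_cod (c := c)) _ ((msmoothP _).1 (ci_smooth Hf j) c k)).
by move=> x _; rewrite /= /momentum_map mxE.
Qed.

Lemma mdiff_momentum c p v i : dom c p -> mdiff pi c p v 0 i = mdiff (f i) c p v.
Proof.
move=> cp; have D := msmooth_differentiable msmooth_momentum cp.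
have E : (fun y => (pi \o param c) y 0 i) = f i \o param c.
  by apply/funext => y; rewrite /= /momentum_map mxE.
have := diff_valE v (differentiable_entry 0 i D); rewrite E => E2.
exact: esym E2.
Qed.

Let jac c p : 'M[R]_(2 * n, n) := \matrix_(j, i) mdiff (f i) c p (delta_mx 0 j).

Lemma momentum_jacobian c p v : dom c p -> mdiff pi c p v = v *m jac c p.
Proof.
move=> cp; apply/rowP => i; rewrite mdiff_momentum// mxE.
rewrite /mdiff linear_row_sum; apply: eq_bigr => j _.
by rewrite [jac c p j i]mxE.
Qed.

(** A linear relation between the columns of the Jacobian is one between the
    differentials of the integrals of motion. *)
Lemma mxrank_jacobian c p : dom c p -> \rank (jac c p) = n.
Proof.
move=> cp; rewrite -mxrank_tr; apply/eqP; rewrite -/(row_free _) -kermx_eq0.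
apply/eqP/row_matrixP => l; rewrite row0; set k := row l _.
have kJ : k *m (jac c p)^T = 0 by rewrite /k -row_mul mulmx_ker row0.
apply/rowP => i; rewrite [RHS]mxE.
apply: (ci_indep Hf cp (k := fun i => k 0 i)) => v.
have : (v *m (k *m (jac c p)^T)^T) 0 0 = 0 by rewrite kJ linear0 mulmx0 mxE.
rewrite trmx_mul trmxK mulmxA -momentum_jacobian// mxE => E; rewrite -[RHS]E.
by apply: eq_bigr => j _; rewrite mdiff_momentum// [k^T j 0]mxE mulrC.
Qed.

Lemma momentum_submersion p : submersion_at pi p.
Proof.
move=> c cp w.
have fullJ : row_full (jac c p) by rewrite /row_full mxrank_jacobian.
have /submxP[v ->] : (w <= jac c p)%MS by exact: submx_full.
by exists v; exact: momentum_jacobian.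
Qed.

Lemma open_range_momentum : open (range pi).
Proof.
rewrite openE => _ [p _ <-].
have [c cp] := @manifold_cover _ _ M p.
have ax := (msmoothP _).1 msmooth_momentum c 1.
have := submersion_locally_onto (open_cod (c := c)) (cod_coord cp) ax
  (momentum_submersion cp).
rewrite /= coordK//; apply: (@filterS _ _ (nbhs_filter (pi p))).
by move=> z [x [_ <-]]; exists (param c x).
Qed.

(** The kernel of the differential of the momentum map has dimension [n]; as
    it contains the [n] independent Hamiltonian vectors, these span it. *)
Lemma kernel_momentum c p u : dom c p -> mdiff pi c p u = 0 ->
  exists a : 'I_n -> R, u = \sum_i a i *: ham (f i) c p.
Proof.
move=> cp; rewrite momentum_jacobian// => uJ.
pose X : 'M[R]_(n, 2 * n) := \matrix_i ham (f i) c p.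
have XJ : X *m jac c p = 0.
  apply/row_matrixP => i; rewrite row_mul rowK row0 -momentum_jacobian//.
  apply/rowP => j; rewrite mdiff_momentum// [RHS]mxE.
  by rewrite -(hamiltonian_vfieldP omega (f j) cp) (ci_commute Hf).
have rX : \rank X = n.
  have XO : X *m smx omega c p = (jac c p)^T.
    apply/matrixP => i j; rewrite [RHS]mxE [RHS]mxE.
    rewrite -(hamiltonian_vfieldP omega (f i) cp) /sform /bilin.
    rewrite trmx_delta -colE [RHS]mxE.
    have -> : (X *m smx omega c p) i j = row i (X *m smx omega c p) 0 j.
      by rewrite [RHS]mxE.
    by rewrite row_mul rowK.
  have uO : row_free (smx omega c p) by rewrite row_free_unit sform_unitmx.
  by rewrite -(mxrankMfree X uO) XO mxrank_tr mxrank_jacobian.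
have XK : (X <= kermx (jac c p))%MS by exact/sub_kermxP.
have KX : (kermx (jac c p) <= X)%MS.
  rewrite -(geq_leqif (mxrank_leqif_sup XK)) mxrank_ker rX mxrank_jacobian//.
  by rewrite mul2n -addnn addnK.
have : (u <= X)%MS by apply: submx_trans KX; exact/sub_kermxP.
move=> /submxP[a ->]; exists (fun i => a 0 i); rewrite mulmx_sum_row.
by apply: eq_bigr => i _; rewrite rowK.
Qed.

Lemma momentum_lagrangian b : lagrangian_submanifold omega (fibre pi b).
Proof.
move=> p Fp; exists setT, (fun q => pi q - b).
have sb : msmooth (fun q => pi q - b).
  apply/msmoothP => c k.
  exact: (class_CD (open_cod (c := c)) ((msmoothP _).1 msmooth_momentum c k)
    (class_C_cst _ _ (- b))).
have db c q v : dom c q -> mdiff (fun q => pi q - b) c q v = mdiff pi c q v.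
  move=> cq; have D := differentiableP (msmooth_differentiable msmooth_momentum cq).
  have := diff_valE v (is_diffB D (is_diff_cst b (coord c q))).
  move=> E; apply: etrans E _; exact: subr0.
split; [exact: openT | by [] | exact: sb | |].
- move=> q _; split.
    move=> c cq w; have [v Ev] := momentum_submersion cq w.
    by exists v; rewrite db.
  split; first by move=> /= ->; rewrite subrr.
  by move=> /eqP; rewrite subr_eq0 => /eqP.
- move=> c q u v _ _ cq; rewrite !db// => du dv.
  have [a ->] := kernel_momentum cq du.
  rewrite /sform /bilin !mulmx_suml summxE big1// => i _.
  rewrite -[LHS]/(bilin (smx omega c q) (a i *: ham (f i) c q) v) bilinZl.
  rewrite -[bilin _ _ _]/(sform omega c q _ _) hamiltonian_vfieldP//.
  by rewrite -mdiff_momentum// dv mxE mulr0.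
Qed.

Lemma momentum_fibration : lagrangian_fibration omega pi (range pi).
Proof.
split; [exact: open_range_momentum | by [] | exact: msmooth_momentum |
  exact: momentum_submersion | by move=> b _; exact: momentum_lagrangian].
Qed.

(** Along a fibre the coefficients of the pulled-back form are constant, so that
    there its vector field is the Hamiltonian field of a fixed linear
    combination of the integrals of motion. *)
Lemma complete_pullback (alpha : 'rV[R]_n -> 'rV[R]_n) b :
  (forall i, complete_on (fibre pi b) (ham (f i))) ->
  complete_on (fibre pi b) (sharp omega (pullback pi alpha)).
Proof.
move=> cF p Fp; pose a i := alpha b 0 i.
have f0 c q (i j : 'I_n) : dom c q ->
    sform omega c q (ham (f i) c q) (ham (f j) c q) = 0.
  by move=> cq; exact: (ci_commute Hf).
have [sg cg dg] := complete_ham_sum a (index_enum 'I_n) (ci_smooth Hf) f0 cF.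
have [gamma [g0 ig Fg]] := cg p Fp.
exists gamma; split=> //; apply: integral_curve_ext ig => c t ct.
apply: sharp_uniq => // v.
apply: etrans (hamiltonian_vfieldP omega _ ct v) _.
rewrite dg// /pullback (Fg t); apply: eq_bigr => i _.
by rewrite mdiff_momentum.
Qed.

End IntegrableFibration.

Theorem proposition3p8 (R : realType) (n : nat) (n_gt0 : (0 < n)%N)
    (M : manifold R (2 * n)%N) (omega : symplectic M)
    (H : M -> R) (f : 'I_n -> M -> R)
    (Hf : completely_integrable omega H f)
    (f_complete : forall b : 'rV[R]_n, range (momentum_map f) b ->
       forall i : 'I_n,
         complete_on (fibre (momentum_map f) b)
                     (hamiltonian_vfield omega (f i))) :
  complete_lagrangian_fibration omega (momentum_map f)
    (range (momentum_map f)).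
Proof.
split; first exact: (momentum_fibration Hf).
move=> alpha _ _ p _.
have [|gamma [g0 ig _]] :=
  complete_pullback Hf alpha (b := momentum_map f p) _ (erefl _).
  by apply: f_complete; exists p.
by exists gamma; split.
Qed.
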